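(* Let $a,b,c,d,\lambda$ be integers with $ad-bc=1$, and let $A$ be the operator with matrix $\begin{pmatrix} a & c+\lambda a\\ b & d+\lambda b\end{pmatrix}\in SL(2,\mathbb Z)$. (i) Let $a=0$, $b=1$, $d=1$. If $\lambda>2$, then $A$ is hyperbolic, its sails are algebraic, and one of the periods of the LLS-sequence of $A$ is $(1,\lambda-1)$. (ii) Let $b>a\ge 1$, $0<d\le b$, $\lambda\ge 1$, and let the odd ordinary continued fraction of $b/a$ be $[a_0:a_1;\ldots;a_{2n}]$. Then $A$ is hyperbolic, its sails are algebraic, and one of the periods of the LLS-sequence of $A$ is $(a_0,a_1,\ldots,a_{2n},\lambda)$.
   Context: For integers $a_0$ and $a_1,\ldots,a_n>0$, the ordinary continued fraction $[a_0:a_1;\ldots;a_n]$ is the rational $a_0+1/(a_1+1/(a_2+\ldots))$; it is called odd if it has an odd number of elements ($n$ even). Every rational has a unique odd ordinary continued fraction. An operator is hyperbolic if it has two distinct real eigenvalues. For a hyperbolic operator with no integer eigenvectors, the complement of the union of its two eigenlines consists of four open octants; for each octant, the boundary of the convex hull of all integer points except the origin in the closure of the octant is a sail, a broken line $\ldots V_{-1}V_0V_1\ldots$ infinite in both directions. Sails of a hyperbolic operator in $SL(2,\mathbb Z)$ whose characteristic polynomial is irreducible over $\mathbb Q$ are called algebraic. The integer length $\mathrm{il}(PQ)$ of an integer segment is the number of its interior integer points plus one; the integer sine $\mathrm{isin}(QPR)$ of an angle formed by non-collinear integer segments $PQ,PR$ is the index in $\mathbb Z^2$ of the sublattice generated by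 the integer vectors of the lines $PQ$ and $PR$. The LLS-sequence of a sail $\ldots V_{-1}V_0V_1\ldots$ is $(\ldots,\mathrm{il}(V_{-1}V_0),\mathrm{isin}\angle V_{-1}V_0V_1,\mathrm{il}(V_0V_1),\mathrm{isin}\angle V_0V_1V_2,\ldots)$, considered up to shift and reversal; all sails of the operator have the same LLS-sequence in this sense, which is called the LLS-sequence of the operator. A finite sequence $(p_1,\ldots,p_m)$ is a period of a two-sided sequence if the two-sided sequence is obtained (up to shift) by repeating $(p_1,\ldots,p_m)$ infinitely in both directions. *)

(* Defs.v *)
(* MathComp-Analysis; the plane is 'cV[R]_2 for a real type R, and operators
   act on column vectors. *)
From HB Require Import structures.
From mathcomp Require Import all_boot all_order all_algebra.
From mathcomp Require Import finmap.
From mathcomp Require Import all_classical all_reals all_analysis.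

Set Implicit Arguments.
Unset Strict Implicit.
Unset Printing Implicit Defensive.

Import Order.TTheory GRing.Theory Num.Theory.
Import numFieldNormedType.Exports.

Local Open Scope classical_set_scope.
Local Open Scope ring_scope.

Definition mx2 (T : Type) (x y z w : T) : 'M[T]_2 :=
  \matrix_(i < 2, j < 2) nth x (nth [::] [:: [:: x; y]; [:: z; w]] i) j.

(** * Ordinary continued fractions *)

(* The last step is x + 0^-1 = x; with positive elements after the first one,
   this is the only place where 0 is inverted. *)
Fixpoint cfrac (s : seq int) : rat :=
  if s is x :: s' then x%:~R + (cfrac s')^-1 else 0.

Definition odd_ocf (s : seq int) (q : rat) : Prop :=
  [/\ odd (size s), all (fun x : int => 0 < x) (behead s) & cfrac s = q].

(** * Hyperbolic operators and their sails *)

Section Sails.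
Variable R : realType.
Implicit Types (A : 'M[int]_2) (P Q S : 'cV[int]_2) (V : int -> 'cV[int]_2).

Definition realmx (m n : nat) (A : 'M[int]_(m, n)) : 'M[R]_(m, n) :=
  map_mx intr A.

(* The library's [eigenvalue] is about row vectors; row and column vectors
   give the same eigenvalues. *)
Definition hyperbolic A : Prop :=
  exists k l : R,
    [/\ k != l, eigenvalue (realmx A) k & eigenvalue (realmx A) l].

Definition eigenline A (k : R) : set 'cV[R]_2 :=
  [set v | realmx A *m v = k *: v].

Definition eigenlines A : set 'cV[R]_2 :=
  \bigcup_(k in [set k | eigenvalue (realmx A) k]) eigenline A k.

Definition octant A (O : set 'cV[R]_2) : Prop :=
  exists2 v, (~` eigenlines A) v & O = connected_component (~` eigenlines A) v.

Definition convex_hull (X : set 'cV[R]_2) : set 'cV[R]_2 :=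
  smallest (@convex_set R 'cV[R]_2) X.

Definition boundary (X : set 'cV[R]_2) : set 'cV[R]_2 :=
  closure X `\` interior X.

Definition nonzero_integer_points (X : set 'cV[R]_2) : set 'cV[R]_2 :=
  [set realmx P | P in [set P : 'cV[int]_2 | P != 0]] `&` X.

(* Meant for hyperbolic A without integer eigenvectors, for instance with a
   characteristic polynomial irreducible over the rationals. *)
Definition sail A (X : set 'cV[R]_2) : Prop :=
  exists2 O, octant A O &
    X = boundary (convex_hull (nonzero_integer_points (closure O))).

Definition sails_algebraic A : Prop :=
  [/\ hyperbolic A, \det A = 1 &
      irreducible_poly (map_poly intr (char_poly A) : {poly rat})].

Definition segment (p q : 'cV[R]_2) : set 'cV[R]_2 :=
  [set (1 - t) *: p + t *: q | t in `[0, 1]%classic].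

Definition open_segment (p q : 'cV[R]_2) : set 'cV[R]_2 :=
  [set (1 - t) *: p + t *: q | t in `]0, 1[%classic].

Definition collinear (p q r : 'cV[R]_2) : Prop :=
  exists o v : 'cV[R]_2,
    {in [:: p; q; r], forall x, exists t : R, x = o + t *: v}.

(* V lists the consecutive vertices of the two-sided infinite broken line X;
   there is a genuine angle at each of them. *)
Definition broken_line (X : set 'cV[R]_2) V : Prop :=
  [/\ X = \bigcup_(i in [set: int]) segment (realmx (V i)) (realmx (V (i + 1))),
      injective V &
      forall i, ~ collinear (realmx (V (i - 1))) (realmx (V i))
                            (realmx (V (i + 1)))].

(** * Integer length, integer sine, LLS-sequence *)

Definition il P Q : nat :=
  #|` fset_set [set S | open_segment (realmx P) (realmx Q) (realmx S)]|.+1.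

Definition line_vectors P Q : set 'cV[int]_2 :=
  [set u | exists t : R, realmx u = t *: realmx (Q - P)].

(* The number of cosets of L; it is 0 if there are infinitely many of them. *)
Definition sublattice_index (L : set 'cV[int]_2) : nat :=
  #|` fset_set [set [set x + u | u in L] | x in [set: 'cV[int]_2]]|.

(* The angle QPS has vertex P; it is assumed not to be flat. *)
Definition isin Q P S : nat :=
  sublattice_index
    [set w | exists u v, [/\ line_vectors P Q u, line_vectors P S v & w = u + v]].

(* Even indices carry integer lengths of edges, odd ones integer sines. *)
Definition LLS V (i : int) : int :=
  let k := (i %/ 2)%Z in
  if (2 %| i)%Z then (il (V k) (V (k + 1)))%:Z
  else (isin (V k) (V (k + 1)) (V (k + 2)))%:Z.

Definition is_period (p : seq int) (s : int -> int) : Prop :=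
  p != [::] /\
  exists k : int, forall i : int, s (i + k) = p`_(`|(i %% size p)%Z|%N).

(* Each sail is a broken line, and p is a period of its LLS-sequence, which is
   considered up to shift and reversal. *)
Definition LLS_period A (p : seq int) : Prop :=
  forall X, sail A X ->
    (exists V, broken_line X V) /\
    (forall V, broken_line X V ->
       is_period p (LLS V) \/ is_period p (fun i => LLS V (- i))).

End Sails.

(* Main.v *)
(* The vertices of two adjacent sails can be generated together, like the even
   and odd convergents of a two-sided infinite continued fraction with partial
   quotients q: V_{k+1} = V_k + q_{2k} U_k and U_{k+1} = U_k + q_{2k+1} V_{k+1}.
   All pairs (V_k, U_k), (V_{k+1}, U_k) are bases of Z^2 of the same
   orientation, so that il(V_k V_{k+1}) = q_{2k} and the integer sine at V_{k+1}
   is q_{2k+1}.  The line of the k-th edge V_k V_{k+1} is directed by U_k, a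
   primitive vector pointing into the neighbouring octant; hence every nonzero
   integer point of the octant lies on that line or beyond it, and the convex
   hull is the intersection of these half-planes.  For the operator A, the V_k
   and U_k are chosen with A V_k = V_{k+m}, A U_k = U_{k+m}, starting from e_1,
   e_2 in (ii), where the continued fraction of b/a leads to (c, d) and (a, b),
   and from e_1, e_2 - e_1 in (i).  This settles one octant; the opposite one
   has vertices -V_k, and the other two have vertices U_k and -U_k.  *)
Require Import Defs.
From mathcomp Require Import all_boot all_order all_algebra.
From mathcomp Require Import all_classical all_reals all_analysis.
From mathcomp Require Import ring lra zify.
(* Restores the names shadowed by the libraries, such as [realmx]. *)
Import Defs.

Set Implicit Arguments.
Unset Strict Implicit.
Unset Printing Implicit Defensive.

Import Order.TTheory GRing.Theory Num.Theory.
Import numFieldNormedType.Exports.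

Local Open Scope classical_set_scope.
Local Open Scope ring_scope.

(** * Integer length and integer sine *)

Section Det2.
Variable T : comNzRingType.
Implicit Types (u v w x : 'cV[T]_2) (k : T).

Definition det2 u v : T := u 0 0 * v 1 0 - u 1 0 * v 0 0.

Lemma cV2P u v : u 0 0 = v 0 0 -> u 1 0 = v 1 0 -> u = v.
Proof.
move=> e0 e1; apply/matrixP => i j; rewrite (ord1 j).
case: i => [[|[|//]] h]; [move: e0|move: e1].
  by congr (u _ _ = v _ _); apply: val_inj.
by congr (u _ _ = v _ _); apply: val_inj.
Qed.

Lemma det2C u v : det2 u v = - det2 v u.
Proof. by rewrite /det2; ring. Qed.

Lemma det2xx u : det2 u u = 0.
Proof. by rewrite /det2; ring. Qed.

Lemma det2Dr u v w : det2 u (v + w) = det2 u v + det2 u w.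
Proof. by rewrite /det2 !mxE; ring. Qed.

Lemma det2Zr u k v : det2 u (k *: v) = k * det2 u v.
Proof. by rewrite /det2 !mxE; ring. Qed.

Lemma det2Dl u v w : det2 (u + v) w = det2 u w + det2 v w.
Proof. by rewrite /det2 !mxE; ring. Qed.

Lemma det2Zl u k v : det2 (k *: u) v = k * det2 u v.
Proof. by rewrite /det2 !mxE; ring. Qed.

Lemma det2Nl u v : det2 (- u) v = - det2 u v.
Proof. by rewrite /det2 !mxE; ring. Qed.

Lemma det2Nr u v : det2 u (- v) = - det2 u v.
Proof. by rewrite /det2 !mxE; ring. Qed.

(** The Plücker relation for four vectors of the plane. *)
Lemma det2_exchange u v w x :
  det2 u w * det2 v x - det2 u x * det2 v w = det2 u v * det2 w x.
Proof. by rewrite /det2; ring. Qed.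

Lemma cramer2 u v w : det2 u w *: v = det2 v w *: u + det2 u v *: w.
Proof. by apply: cV2P; rewrite /det2 !mxE; ring. Qed.

(** A determinant with square 1 is its own inverse, so Cramer's rule needs no division, for either
    orientation. *)
Lemma basis_coords u w v : det2 u w ^+ 2 = 1 ->
  v = (det2 u w * det2 v w) *: u + (det2 u w * det2 u v) *: w.
Proof.
move=> d1; have /(congr1 (fun x => det2 u w *: x)) := cramer2 u v w.
by rewrite scalerDr !scalerA -expr2 d1 scale1r.
Qed.

End Det2.

Definition det2E := (det2Dl, det2Dr, det2Zl, det2Zr, det2Nl, det2Nr, det2xx).

Lemma sqr_eq1_neq0 (T : nzRingType) (x : T) : x ^+ 2 = 1 -> x != 0.
Proof. by move=> x1; apply/eqP => x0; move/eqP: x1;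
  rewrite x0 expr0n eq_sym oner_eq0. Qed.

Section IntegerLengthAndSine.
Variable R : realType.
Implicit Types (P Q S u e w : 'cV[int]_2) (n m : int).
Notation rmx := (@realmx R _ _).

Lemma det2_realmx u w : det2 (rmx u) (rmx w) = (det2 u w)%:~R.
Proof. by rewrite /det2 !mxE -!intrM -rmorphB. Qed.

Lemma realmxD u w : rmx (u + w) = rmx u + rmx w.
Proof. exact: map_mxD. Qed.

Lemma realmxB u w : rmx (u - w) = rmx u - rmx w.
Proof. exact: map_mxB. Qed.

Lemma realmxN u : rmx (- u) = - rmx u.
Proof. exact: map_mxN. Qed.

Lemma realmxZ n u : rmx (n *: u) = n%:~R *: rmx u.
Proof. exact: map_mxZ. Qed.

Lemma realmx_inj : injective (@realmx R 2 1).
Proof.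
move=> u w /matrixP uw; apply/matrixP => i j; apply: (@intr_inj R).
by have := uw i j; rewrite !mxE.
Qed.

Section Basis.
Variables u e : 'cV[int]_2.
Hypothesis ue1 : det2 u e ^+ 2 = 1.

Lemma scale_inj n m : n *: u = m *: u -> n = m.
Proof.
move=> /(congr1 (fun x => det2 x e)); rewrite !det2E; apply: mulIf.
exact: sqr_eq1_neq0.
Qed.

(** Since [u] belongs to a basis of Z^2, the coordinate along [u] of an integer vector is an
    integer. *)
Lemma primitive_line w (t : R) : rmx w = t *: rmx u ->
  exists2 n, w = n *: u & t = n%:~R.
Proof.
move=> wt; have uw0 : det2 u w = 0.
  by apply: (@intr_inj R); rewrite -det2_realmx wt det2Zr det2xx mulr0.
exists (det2 u e * det2 w e).
  by rewrite {1}(basis_coords w ue1) uw0 mulr0 scale0r addr0.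
rewrite intrM -!det2_realmx wt det2Zl mulrCA -expr2 det2_realmx -rmorphXn /=.
by rewrite ue1 mulr1.
Qed.

Lemma line_vectors_primitive P n : n != 0 ->
  line_vectors R P (P + n *: u) = [set i *: u | i in [set: int]].
Proof.
move=> n0; apply/seteqP; split=> [w [t]|_ [i _ <-]].
  rewrite addrAC subrr add0r realmxZ scalerA => /primitive_line [i -> _].
  by exists i.
exists (i%:~R / n%:~R); rewrite addrAC subrr add0r !realmxZ scalerA divfK //.
by rewrite intr_eq0.
Qed.

Lemma il_primitive P n : 0 < n -> il R P (P + n *: u) = `|n|%N.
Proof.
case: n => [[|n]|] // _; rewrite /il; congr _.+1.
apply: card_fset_set.
(* After the case analysis the length is [n.+1], and the interior integer points are [P + u], ...,
   [P + n u]. *)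
rewrite (_ : [set _ | _] = (fun i : nat => P + i.+1%:Z *: u) @` `I_n).
  apply: inj_card_eq.
  by move=> i j _ _ /addrI /scale_inj [].
apply/seteqP; split=> [S [t]|_ [i lin <-]].
  rewrite /= in_itv /= => /andP[t0 t1] tS.
  have /primitive_line [i Si ti] : rmx (S - P) = (t * n.+1%:Z%:~R) *: rmx u.
    rewrite realmxB -tS realmxD realmxZ; apply: cV2P; rewrite !mxE; ring.
  have i0 : 0 < i by rewrite -(@ltr0z R) -ti mulr_gt0 // ltr0z.
  have i1 : i < n.+1%:Z.
    by rewrite -(@ltr_int R) -ti gtr_pMl // ltr0z.
  case: i Si i0 i1 {ti} => [[|i]|] // Si _ i1; exists i => /=; first by lia.
  by rewrite -Si addrC subrK.
exists (i.+1%:Z%:~R / n.+1%:Z%:~R).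
  rewrite /= in_itv /= divr_gt0 ?ltr0z // ltr_pdivrMr ?ltr0z // mul1r ltr_int.
  by rewrite /= in lin; lia.
rewrite !realmxD !realmxZ; have : n.+1%:Z%:~R != 0 :> R by rewrite intr_eq0.
by move=> n0; apply: cV2P; rewrite !mxE; field.
Qed.

End Basis.

Lemma isinC Q P S : isin R Q P S = isin R S P Q.
Proof.
rewrite /isin; congr sublattice_index; apply/seteqP.
by split=> w [x [y [Hx Hy ->]]]; exists y, x; rewrite addrC.
Qed.

(** The vectors [u] and [u + b e] generate the lattice of the vectors whose [e]-coordinate is
    divisible by [b]; its cosets are represented by [0], [e], ..., [(b - 1) e]. *)
Lemma isin_basis u e P n m (b : int) : det2 u e ^+ 2 = 1 -> 0 < b ->
  n != 0 -> m != 0 ->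
  isin R (P + n *: u) P (P + m *: (u + b *: e)) = `|b|%N.
Proof.
move=> ue1 b0 n0 m0; rewrite /isin.
have ue1' : det2 (u + b *: e) e ^+ 2 = 1 by rewrite !det2E mulr0 addr0.
rewrite (line_vectors_primitive ue1 _ n0) (line_vectors_primitive ue1' _ m0).
set L := [set w | _].
(* Up to sign, [det2 u w] is the [e]-coordinate of [w]. *)
have LP w : L w <-> (b %| det2 u w)%Z.
  split=> [[_ [_ [[i _ <-] [j _ <-] ->]]]|/dvdzP [k kE]].
    rewrite (_ : det2 u _ = b * (j * det2 u e)) ?dvdz_mulr //.
    by rewrite !det2E; ring.
  have := basis_coords w ue1; set x := _ * det2 w e; rewrite kE => ->.
  exists ((x - det2 u e * k) *: u), ((det2 u e * k) *: (u + b *: e)).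
  split; [by eexists|by eexists|].
  by rewrite scalerBl scalerDr scalerA mulrA addrA subrK.
have LB v w : L v -> L w -> L (v - w).
  by move=> /LP ? /LP ?; apply/LP; rewrite det2Dr det2Nr; apply: rpredB.
have LD v w : L v -> L w -> L (v + w).
  by move=> /LP ? /LP ?; apply/LP; rewrite det2Dr; apply: rpredD.
have L0 : L 0 by apply/LP; rewrite /det2 !mxE !mulr0 subr0 dvdz0.
have coset_eq x y : L (x - y) ->
    [set x + w | w in L] = [set y + w | w in L].
  move=> Lxy; apply/seteqP; split=> _ [w Lw <-].
    by exists (x - y + w); [exact: LD|rewrite addrA [y + _]addrC subrK].
  exists (w - (x - y)); first exact: LB.
  by rewrite opprB [x + _]addrC -addrA subrK addrC.
have eq_coset x y : [set x + w | w in L] = [set y + w | w in L] -> L (x - y).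
  move=> xy; have : [set x + w | w in L] x by exists 0; rewrite ?addr0.
  by rewrite xy => -[w Lw <-]; rewrite addrAC subrr add0r.
apply: card_fset_set.
rewrite (_ : [set _ | _ in _] =
    (fun i : nat => [set i%:Z *: e + w | w in L]) @` `I_`|b|).
  apply: inj_card_eq => i j /=; rewrite !inE => ib jb /eq_coset /LP.
  rewrite det2Dr det2Nr !det2Zr -mulrBl => /(dvdz_mulr (det2 u e)).
  rewrite -mulrA -expr2 ue1 mulr1 => /dvdzP [k kE].
  have k0 : k = 0.
    have [//|kn0] := eqVneq k 0.
    have : `|b| <= `|i%:Z - j%:Z| by rewrite kE normrM ler_peMl // -gtz0_ge1
      normr_gt0.
    have {}ib : (i < `|b|)%N by exact: ib.
    have {}jb : (j < `|b|)%N by exact: jb.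
    by lia.
  by move: kE; rewrite k0; lia.
apply/seteqP; split=> [_ [x _ <-]|_ [i _ <-]]; last by exists (i%:Z *: e).
pose i := ((det2 u e * det2 u x) %% b)%Z.
have i0 : 0 <= i by rewrite modz_ge0 // gt_eqF.
have ib : i < b by apply: ltz_pmod.
exists `|i|%N; first by rewrite /=; lia.
apply: coset_eq; apply/LP; rewrite gez0_abs // det2Dr det2Nr det2Zr.
have -> : det2 u x = det2 u e * (det2 u e * det2 u x).
  by rewrite mulrA -expr2 ue1 mul1r.
rewrite [i * _]mulrC -mulrBr; apply: dvdz_mull.
rewrite {1}(divz_eq (det2 u e * det2 u x) b) -/i opprD addrCA subrr addr0.
by rewrite -mulNr dvdz_mull.
Qed.

End IntegerLengthAndSine.

(** * The sail through given convergents *)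

Lemma det2_separates (F : fieldType) (a b v : 'cV[F]_2) :
  det2 a b != 0 -> det2 a v = 0 -> det2 b v = 0 -> v = 0.
Proof.
move=> ab av bv; have vb : det2 v b = 0 by rewrite det2C bv oppr0.
have := cramer2 a v b; rewrite av vb !scale0r addr0.
by move/eqP; rewrite scaler_eq0 (negPf ab) => /eqP.
Qed.

Lemma PoszS (n : nat) : n.+1%:Z = n%:Z + 1.
Proof. by rewrite -addn1. Qed.

Lemma int_shift_ind (P : int -> Prop) :
  P 0 -> (forall k, P k <-> P (k + 1)) -> forall k, P k.
Proof.
move=> P0 PS; elim/int_rect => [//|n /PS|n].
  by rewrite -[n.+1]addn1 PoszD.
by move=> Pn; apply/PS; rewrite -addn1 PoszD opprD addrNK.
Qed.

Lemma int_crossing (P : pred int) (m n : int) : m <= n ->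
  P m -> ~~ P n -> exists2 k, P k & ~~ P (k + 1).
Proof.
move=> mn; rewrite -(subrK m n) addrC; have : 0 <= n - m by rewrite subr_ge0.
case: (n - m) => // d _; elim: d => [|d IH]; first by rewrite addr0 => ->.
move=> Pm Pd; have [Pd'|] := boolP (P (m + d)); last exact: IH.
by exists (m + d) => //; rewrite -addrA -PoszD addn1.
Qed.

Lemma det2_continuous (R : realType) (u : 'cV[R]_2) : continuous (det2 u).
Proof.
have c i : continuous (fun w : 'cV[R]_2 => w i 0) by exact: coord_continuous.
move=> v; have F : Filter (nbhs v) by exact: nbhs_filter.
by apply: cvgB; apply: cvgMl_tmp; exact: c.
Qed.

Lemma convex_setP (R : realType) (B : set 'cV[R]_2) :
  convex_set B <->
  forall v w (t : R), B v -> B w -> 0 <= t <= 1 -> B ((1 - t) *: v + t *: w).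
Proof.
split=> [cB v w t Bv Bw /andP[t0 t1]|cB v w l].
  have := cB w v (Itv01 t0 t1); rewrite !inE => /(_ Bw Bv).
  by rewrite addrC.
rewrite !inE => Bv Bw; have := cB w v l%:num Bw Bv.
by rewrite addrC; apply; rewrite ge0 le1.
Qed.

Lemma collinear_det2 (R : realType) (p q r : 'cV[R]_2) :
  Defs.collinear p q r -> det2 (q - p) (r - q) = 0.
Proof.
case=> [x [v h]].
have [|a ->] := h p; first by rewrite !inE eqxx.
have [|b ->] := h q; first by rewrite !inE eqxx ?orbT.
have [|c ->] := h r; first by rewrite !inE eqxx ?orbT.
by rewrite /det2 !mxE; ring.
Qed.

Lemma ilC (R : realType) (P Q : 'cV[int]_2) : il R P Q = il R Q P.
Proof.
rewrite /il; suff -> : open_segment (realmx R P) (realmx R Q) =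
  open_segment (realmx R Q) (realmx R P) by [].
by apply/seteqP; split=> _ [t /= tI <-]; (exists (1 - t);
  [by move: tI; rewrite /= !in_itv /= subr_gt0 gtrBl andbC
  |by rewrite subKr [LHS]addrC]).
Qed.

(** Without turning back, unit steps keep the direction of the first one. This will compare two
    enumerations of the vertices of a sail. *)
Lemma int_walk (s : int -> int) :
  (forall i : int, s (i + 1) = s i + 1 \/ s (i + 1) = s i - 1) ->
  (forall i : int, s (i + 1 + 1) <> s i) ->
  (forall i, s i = s 0 + i) \/ (forall i, s i = s 0 - i).
Proof.
move=> step turn; case: (step 0) => s01; [left|right].
  have up (i : int) : s (i + 1) = s i + 1.
    move: i; apply: int_shift_ind => // k.
    have := step k; have := step (k + 1); have := turn k; lia.
  by apply: int_shift_ind => [|k]; rewrite ?addr0 // up; split; lia.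
have down (i : int) : s (i + 1) = s i - 1.
  move: i; apply: int_shift_ind => // k.
  have := step k; have := step (k + 1); have := turn k; lia.
by apply: int_shift_ind => [|k]; rewrite ?subr0 // down; split; lia.
Qed.

Section Sail.
Variables (R : realType) (al be : 'cV[R]_2) (q : int -> int).
Variables V U : int -> 'cV[int]_2.
Notation rmx := (@realmx R _ _).
Notation X := (det2 al).
Notation Y := (det2 be).
Hypothesis q_gt0 : forall i, 0 < q i.
Hypothesis VS : forall k : int, V (k + 1) = V k + q (2 * k) *: U k.
Hypothesis US : forall k : int, U (k + 1) = U k + q (2 * k + 1) *: V (k + 1).
Hypothesis VU0 : det2 (V 0) (U 0) ^+ 2 = 1.
(** The octant of the sail is where [X] and [Y] are positive; the [U k] lie in the neighbouring
    octant across the line [Y = 0]. *)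
Hypothesis XV : forall k, 0 < X (rmx (V k)).
Hypothesis XU : forall k, 0 < X (rmx (U k)).
Hypothesis YV : forall k, 0 < Y (rmx (V k)).
Hypothesis YU : forall k, Y (rmx (U k)) < 0.

(** The orientation of the bases is left open, since exchanging the two adjacent sails reverses
    it. *)
Let eps := det2 (V 0) (U 0).

Lemma q_ge1 i : (1 : R) <= (q i)%:~R.
Proof. by rewrite ler1z -gtz0_ge1. Qed.

Lemma q_ge0 i : (0 : R) <= (q i)%:~R.
Proof. exact: le_trans ler01 (q_ge1 i). Qed.

Lemma rVS (k : int) : rmx (V (k + 1)) = rmx (V k) +
  (q (2 * k))%:~R *: rmx (U k).
Proof. by rewrite VS realmxD realmxZ. Qed.

Lemma rUS (k : int) :
  rmx (U (k + 1)) = rmx (U k) + (q (2 * k + 1))%:~R *: rmx (V (k + 1)).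
Proof. by rewrite US realmxD realmxZ. Qed.

Lemma detVSU k : det2 (V (k + 1)) (U k) = det2 (V k) (U k).
Proof. by rewrite VS !det2E mulr0 addr0. Qed.

Lemma detVU k : det2 (V k) (U k) = eps.
Proof.
move: k; apply: int_shift_ind => // k.
by rewrite US det2Dr det2Zr det2xx mulr0 addr0 detVSU.
Qed.

Let epsR : R := eps%:~R.

Lemma epsR2 : epsR ^+ 2 = 1.
Proof. by rewrite /epsR -rmorphXn /= VU0. Qed.

Lemma rdetVU k : det2 (rmx (V k)) (rmx (U k)) = epsR.
Proof. by rewrite det2_realmx detVU. Qed.

Lemma rdetVSU k : det2 (rmx (V (k + 1))) (rmx (U k)) = epsR.
Proof. by rewrite det2_realmx detVSU detVU. Qed.

(* The k-th edge of the sail lies on the line where [height k] is 1. *)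
Definition height k v : R := epsR * det2 v (rmx (U k)).

Lemma heightD k v w : height k (v + w) = height k v + height k w.
Proof. by rewrite /height det2Dl mulrDr. Qed.

Lemma heightZ k t v : height k (t *: v) = t * height k v.
Proof. by rewrite /height det2Zl mulrCA. Qed.

Lemma heightV k : height k (rmx (V k)) = 1.
Proof. by rewrite /height rdetVU -expr2 epsR2. Qed.

Lemma heightVS k : height k (rmx (V (k + 1))) = 1.
Proof. by rewrite /height rdetVSU -expr2 epsR2. Qed.

Lemma heightU k : height k (rmx (U k)) = 0.
Proof. by rewrite /height det2xx mulr0. Qed.

Let D := - det2 al be * epsR.

(** By the Plücker relation. As [X] is positive and [Y] negative at [U k], the height is, up to the
    positive factor [D], a combination of [X] and [Y] with positive coefficients. *)
Lemma D_height k v :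
  D * height k v = X (rmx (U k)) * Y v - X v * Y (rmx (U k)).
Proof.
have := det2_exchange al be v (rmx (U k)) => /(congr1 -%R).
rewrite opprB => ->; rewrite /D /height.
by rewrite -[LHS]mulrA [epsR * (_ * _)]mulrA -expr2 epsR2 mul1r mulNr.
Qed.

Lemma D_gt0 : 0 < D.
Proof.
have := D_height 0 (rmx (V 0)); rewrite heightV mulr1 => ->.
by rewrite subr_gt0 (@lt_trans _ _ 0) ?pmulr_rlt0 ?mulr_gt0.
Qed.

Lemma XY_eq0 v : X v = 0 -> Y v = 0 -> v = 0.
Proof.
apply: det2_separates; apply: contraTneq D_gt0 => ab0.
by rewrite /D ab0 oppr0 mul0r ltxx.
Qed.

Lemma height_ge0 k v : 0 <= X v -> 0 <= Y v -> 0 <= height k v.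
Proof.
move=> Xv Yv; rewrite -(pmulr_rge0 _ D_gt0) D_height subr_ge0.
by rewrite (@le_trans _ _ 0) ?mulr_ge0_le0 ?mulr_ge0 // ltW.
Qed.

Lemma height_gt0 k v : 0 <= X v -> 0 <= Y v -> v != 0 -> 0 < height k v.
Proof.
move=> Xv Yv v0; rewrite lt_neqAle height_ge0 // andbT eq_sym.
apply: contra_neq v0 => h0; have := D_height k v; rewrite h0 mulr0.
have XUY : 0 <= X (rmx (U k)) * Y v by rewrite mulr_ge0 // ltW.
have XYU : 0 <= X v * - Y (rmx (U k)) by rewrite mulr_ge0 // oppr_ge0 ltW.
rewrite -mulrN => /esym/eqP; rewrite paddr_eq0 // !mulf_eq0 oppr_eq0.
by rewrite (gt_eqF (XU k)) (lt_eqF (YU k)) orbF /= => /andP[/eqP ? /eqP ?];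
  exact: XY_eq0.
Qed.

Definition polygon : set 'cV[R]_2 := [set v | forall k, 1 <= height k v].

Lemma polygonD v w : polygon v -> 0 <= X w -> 0 <= Y w -> polygon (v + w).
Proof. by move=> Gv Xw Yw k; rewrite heightD ler_wpDr ?height_ge0. Qed.

Lemma polygon_conv v w (t : R) : polygon v -> polygon w -> 0 <= t <= 1 ->
  polygon ((1 - t) *: v + t *: w).
Proof.
move=> Gv Gw /andP[t0 t1] k; rewrite heightD !heightZ.
apply: (@le_trans _ _ ((1 - t) * 1 + t * 1)); first by rewrite !mulr1 subrK.
by rewrite lerD // ler_wpM2l // subr_ge0.
Qed.

(** On integer vectors the height takes integer values, so positive means at least 1. *)
Lemma polygon_integer (w : 'cV[int]_2) :
  w != 0 -> 0 <= X (rmx w) -> 0 <= Y (rmx w) -> polygon (rmx w).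
Proof.
move=> w0 Xw Yw k; have : 0 < height k (rmx w).
  apply: height_gt0 => //; apply: contra_neq w0 => w0.
  by apply: (@realmx_inj R); rewrite w0; apply/matrixP => i j; rewrite !mxE.
by rewrite /height det2_realmx -intrM ltr0z ler1z gtz0_ge1.
Qed.

Lemma V_neq0 k : V k != 0.
Proof.
apply: contraTneq (XV k) => ->; rewrite /det2 !mxE !mulr0 subrr ltxx //.
Qed.

Lemma polygonV k : polygon (rmx (V k)).
Proof. by apply: polygon_integer; rewrite ?V_neq0 // ltW. Qed.

(** * Monotonicity and growth of the vertices *)

Lemma XVS_lt k : X (rmx (V k)) < X (rmx (V (k + 1))).
Proof. by rewrite rVS det2Dr det2Zr ltrDl mulr_gt0 // ltr0z. Qed.

Lemma XV_lt k l : k < l -> X (rmx (V k)) < X (rmx (V l)).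
Proof.
move=> kl; rewrite -(subrK k l) addrC.
have : 0 < l - k by rewrite subr_gt0.
case: (l - k) => [[|n]|] // _; elim: n => [|n IH]; first exact: XVS_lt.
by apply: lt_trans IH _; rewrite [n.+2%:Z]PoszS addrA XVS_lt.
Qed.

Lemma XV_le k l : k <= l -> X (rmx (V k)) <= X (rmx (V l)).
Proof. by rewrite le_eqVlt => /orP[/eqP ->//|/XV_lt/ltW]. Qed.

Lemma YVS_lt k : Y (rmx (V (k + 1))) < Y (rmx (V k)).
Proof. by rewrite rVS det2Dr det2Zr gtrDl pmulr_rlt0 // ltr0z. Qed.

Lemma YV_nat_le (n : nat) : Y (rmx (V n)) <= Y (rmx (V 0)).
Proof.
elim: n => // n; apply: le_trans.
by rewrite PoszS ltW // YVS_lt.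
Qed.

(** Each step adds at least [X (U n)], which never drops below [X (U 0)]; hence linear growth. *)
Lemma XV_growth (n : nat) :
  X (rmx (V 0)) + n%:R * X (rmx (U 0)) <= X (rmx (V n)) /\
  X (rmx (U 0)) <= X (rmx (U n)).
Proof.
elim: n => [|n [IHV IHU]]; first by rewrite mul0r addr0.
have q0 := q_ge1 (2 * n).
rewrite -[n.+1%:R]natr1 PoszS rUS det2Dr det2Zr rVS !det2Dr !det2Zr.
have := XU n; have := XV n; have := XU 0; split; last first.
  by apply: le_trans IHU _; rewrite lerDl mulr_ge0 ?q_ge0 // addr_ge0 ?mulr_ge0
    ?q_ge0 ?ltW.
by rewrite mulrDl addrA lerD // mul1r (le_trans IHU) // ler_peMl // ltW.
Qed.

(** The mirror image of the growth of [X]. Going back from [V (- n)] adds a multiple of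
    [- U (- n - 1)], hence the index shift. *)
Lemma YV_growth (n : nat) :
  Y (rmx (V 0)) + n%:R * - Y (rmx (U (- 1))) <= Y (rmx (V (- n%:Z))) /\
  - Y (rmx (U (- 1))) <= - Y (rmx (U (- n%:Z - 1))).
Proof.
elim: n => [|n [IHV IHU]]; first by rewrite mul0r addr0 oppr0 add0r.
set k := - n.+1%:Z; have kE : - n%:Z = k + 1 by rewrite /k; lia.
clearbody k.
move: IHV IHU; rewrite kE addrK => IHV IHU.
have q0 := q_ge1 (2 * k).
have YVk := YV k; have YUk := YU k; have YU1 := YU (- 1).
have := rVS k => /(congr1 Y); rewrite det2Dr det2Zr => YE.
have := rUS (k - 1) => /(congr1 Y); rewrite det2Dr det2Zr subrK => YE'.
split.
  rewrite -natr1.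
  have : Y (rmx (V k)) = Y (rmx (V (k + 1))) +
    (q (2 * k))%:~R * - Y (rmx (U k)).
    by rewrite YE mulrN addrK.
  move=> ->; rewrite mulrDl addrA lerD // mul1r (le_trans IHU) // ler_peMl //.
  by rewrite oppr_ge0 ltW.
apply: le_trans IHU _; rewrite lerN2 YE' lerDl mulr_ge0 //; last exact: ltW.
by rewrite ler0z ltW.
Qed.

Lemma archi_affine (x y M : R) : 0 < y -> exists n : nat, M < x + n%:R * y.
Proof.
move=> y0; exists (Num.bound `|(M - x) / y|).
rewrite -ltrBlDl -ltr_pdivrMr //; apply: le_lt_trans (ler_norm _) _.
exact: archi_boundP.
Qed.

Lemma XV_unbounded M : exists n : nat, M < X (rmx (V n)).
Proof.
have [n nP] := archi_affine (X (rmx (V 0))) M (XU 0).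
by exists n; apply: lt_le_trans nP (XV_growth n).1.
Qed.

Lemma YV_unbounded M : exists n : nat, M < Y (rmx (V (- n%:Z))).
Proof.
have YU1 : 0 < - Y (rmx (U (- 1))) by rewrite oppr_gt0.
have [n nP] := archi_affine (Y (rmx (V 0))) M YU1.
by exists n; apply: lt_le_trans nP (YV_growth n).1.
Qed.

Lemma height_lt1 k v : X v < X (rmx (V k)) -> Y v < Y (rmx (V k)) ->
  height k v < 1.
Proof.
move=> Xlt Ylt; rewrite -(heightV k) -(ltr_pM2l D_gt0) !D_height.
by rewrite ltrB // ?ltr_pM2l // ltr_nM2r.
Qed.

(** If [X v] were not positive, a vertex far back would exceed [v] in both [X] and [Y], giving [v] a
    height below 1 there. For [Y] the vertex is far ahead. *)
Lemma polygon_pos v : polygon v -> 0 < X v /\ 0 < Y v.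
Proof.
move=> Gv; split; rewrite ltNge; apply/negP => v0.
  have [n nP] := YV_unbounded (Y v); have := Gv (- n%:Z).
  by rewrite leNgt height_lt1 // (le_lt_trans v0).
have [n nP] := XV_unbounded (X v); have := Gv n%:Z.
by rewrite leNgt height_lt1 // (le_lt_trans v0).
Qed.

(** * Edges of the polygon *)

Definition edge k : set 'cV[R]_2 := segment (rmx (V k)) (rmx (V (k + 1))).

Lemma edgeP k v : edge k v <->
  exists2 b : R, 0 <= b <= (q (2 * k))%:~R & v = rmx (V k) + b *: rmx (U k).
Proof.
have q0 := q_ge1 (2 * k); rewrite /edge; split=> [[t /= tI <-]|[b bI ->]].
  exists (t * (q (2 * k))%:~R).
    move: tI; rewrite in_itv /= => /andP[t0 t1].
    by rewrite mulr_ge0 ?ler_piMl // ler0z ltW.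
  by rewrite rVS; apply: cV2P; rewrite !mxE; ring.
have qn0 : (q (2 * k))%:~R != 0 :> R by rewrite intr_eq0 gt_eqF.
exists (b / (q (2 * k))%:~R) => /=.
  case/andP: bI => b0 b1.
  by rewrite in_itv /= divr_ge0 ?q_ge0 //= ler_pdivrMr ?mul1r // ltr0z.
by rewrite rVS; apply: cV2P; rewrite !mxE; field.
Qed.

Lemma height_coords k v :
  v = height k v *: rmx (V k) + (epsR * det2 (rmx (V k)) v) *: rmx (U k).
Proof.
have := @basis_coords _ (rmx (V k)) (rmx (U k)) v.
by rewrite rdetVU epsR2 => /(_ erefl).
Qed.

(** The ratio [X / Y] of [V k] is below that of [v] far back and above it far ahead, so the ray of
    [v] crosses the edge where the comparison changes. *)
Lemma cone_cover v : 0 < X v -> 0 < Y v ->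
  exists k, 0 < height k v /\ edge k ((height k v)^-1 *: v).
Proof.
move=> Xv Yv; pose P k := X (rmx (V k)) * Y v <= X v * Y (rmx (V k)).
have [n nP] := XV_unbounded (X v * Y (rmx (V 0)) / Y v).
have [m mP] := YV_unbounded (X (rmx (V 0)) * Y v / X v).
have [|||k Pk PkS] := @int_crossing P (- m%:Z) n; first by lia.
- move: mP; rewrite ltr_pdivrMr // => /ltW mP.
  by rewrite /P [leRHS]mulrC (le_trans _ mP) // ler_pM2r // XV_le.
- rewrite -ltNge; move: nP; rewrite ltr_pdivrMr //; apply: le_lt_trans.
  by rewrite ler_pM2l // YV_nat_le.
(* The comparison is governed by the coefficient of [U j] when [v] is written in the basis [V j],
   [U j]. *)
have crossE j : X (rmx (V j)) * Y v - X v * Y (rmx (V j)) =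
    - D * (epsR * det2 (rmx (V j)) v).
  by rewrite det2_exchange /D !mulNr opprK mulrA -(mulrA (X be)) -expr2 epsR2
    mulr1.
set b := epsR * det2 (rmx (V k)) v.
have b0 : 0 <= b.
  by move: Pk; rewrite /P -subr_le0 crossE mulNr oppr_le0 (pmulr_rge0 _ D_gt0).
have bS : epsR * det2 (rmx (V (k + 1))) v = b - (q (2 * k))%:~R * height k v.
  rewrite rVS det2Dl det2Zl mulrDr -/b /height.
  by rewrite [det2 v _]det2C; ring.
have bqh : b < (q (2 * k))%:~R * height k v.
  move: PkS; rewrite /P -ltNge -subr_gt0 crossE mulNr oppr_gt0.
  by rewrite (pmulr_rlt0 _ D_gt0) bS subr_lt0.
have h0 : 0 < height k v.
  by move: (le_lt_trans b0 bqh); rewrite pmulr_rgt0 // ltr0z.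
exists k; split=> //; apply/edgeP; exists ((height k v)^-1 * b).
  rewrite mulr_ge0 ?invr_ge0 ?(ltW h0) //=.
  by rewrite mulrC ler_pdivrMr // ltW.
rewrite {2}(height_coords k v) scalerDr !scalerA mulVf ?scale1r //.
by rewrite gt_eqF.
Qed.

Lemma edge_height k v : edge k v -> height k v = 1.
Proof.
by move=> /edgeP [b _ ->]; rewrite heightD heightZ heightV heightU mulr0 addr0.
Qed.

Lemma edge_polygon k v : edge k v -> polygon v.
Proof.
move=> [t /=]; rewrite in_itv /= => tI <-.
by apply: polygon_conv => //; exact: polygonV.
Qed.

(** The half-planes of the neighbouring edges cut the line of the edge at its ends: edge [k - 1]
    gives [0 <= b], edge [k + 1] gives [b <= q (2 * k)]. *)
Lemma polygon_edge k v : polygon v -> height k v = 1 -> edge k v.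
Proof.
move=> Gv hv; have := height_coords k v; rewrite hv scale1r.
set b := epsR * _ => vE; apply/edgeP; exists b => //; apply/andP; split.
  have := Gv (k - 1); have := rUS (k - 1); rewrite subrK => UE.
  have := heightVS (k - 1); rewrite subrK => hV.
  rewrite vE heightD heightZ hV UE heightD heightZ heightU hV mulr1 add0r.
  by rewrite lerDl pmulr_lge0 // ltr0z.
have := Gv (k + 1); have UE := rUS k.
have {}vE : v = rmx (V (k + 1)) + (b - (q (2 * k))%:~R) *: rmx (U k).
  by rewrite vE rVS; apply: cV2P; rewrite !mxE; ring.
rewrite {1}vE heightD heightZ heightV lerDl.
have -> : height (k + 1) (rmx (U k)) = - (q (2 * k + 1))%:~R.
  have := heightU (k + 1); rewrite UE heightD heightZ heightV mulr1.
  by move/eqP; rewrite addr_eq0 => /eqP.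
by rewrite mulrN oppr_ge0 pmulr_lle0 ?ltr0z // subr_le0.
Qed.

Lemma edge_X k v : edge k v ->
  [/\ X (rmx (V k)) <= X v, X v <= X (rmx (V (k + 1))) &
      X v = X (rmx (V (k + 1))) -> v = rmx (V (k + 1))].
Proof.
move=> /edgeP [b /andP[b0 bq] ->]; rewrite rVS !det2Dr !det2Zr; split.
- by rewrite lerDl mulr_ge0 // ltW.
- by rewrite lerD2l ler_pM2r.
by move=> /addrI; move/mulIf; rewrite gt_eqF // => ->.
Qed.

(** Because [X] increases strictly along the whole broken line. *)
Lemma edge_meet k l v : k < l -> edge k v -> edge l v ->
  l = k + 1 /\ v = rmx (V (k + 1)).
Proof.
move=> kl /edge_X [_ v1 vE] /edge_X [v2 _ _].
have lk : k + 1 <= l by lia.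
split; last by apply: vE; apply/eqP; rewrite eq_le v1 (le_trans (XV_le lk)).
apply/eqP; rewrite eq_le lk andbT leNgt; apply/negP => /XV_lt.
by rewrite ltNge (le_trans v2).
Qed.

Lemma edge_vertex k j : edge k (rmx (V j)) -> j = k \/ j = k + 1.
Proof.
move=> /edge_X [v1 v2 _].
have kj : k <= j by rewrite leNgt; apply/negP => /XV_lt; rewrite ltNge v1.
have jk : j <= k + 1 by rewrite leNgt; apply/negP => /XV_lt; rewrite ltNge v2.
lia.
Qed.

(** * The convex hull of the integer points and its boundary *)

Definition cone : set 'cV[R]_2 := [set v | 0 < X v /\ 0 < Y v].

Lemma height_det2 k v : height k v = det2 (- epsR *: rmx (U k)) v.
Proof. by rewrite /height det2Zl mulNr -mulrN -det2C. Qed.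

Lemma closed_polygon : closed polygon.
Proof.
rewrite (_ : polygon = \bigcap_(k in [set: int]) [set v | 1 <= height k v]).
  apply: closed_bigI => k _.
  rewrite (_ : [set v | _] = det2 (- epsR *: rmx (U k)) @^-1` [set t | 1 <= t]).
    exact: (continuous_closedP _).1 (@det2_continuous R _) _ (@closed_ge _ _).
  by apply/seteqP; split=> v /=; rewrite height_det2.
by apply/seteqP; split=> [v Gv k _|v Gv k]; [exact: Gv|exact: Gv].
Qed.

Lemma closure_cone v : closure cone v -> 0 <= X v /\ 0 <= Y v.
Proof.
have cl u : closed (det2 u @^-1` [set t : R | 0 <= t]).
  exact: (continuous_closedP _).1 (@det2_continuous R _) _ (@closed_ge _ _).
have sub u : cone `<=` det2 u @^-1` [set t : R | 0 <= t] ->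
    closure cone `<=` det2 u @^-1` [set t : R | 0 <= t].
  by move=> su; rewrite [X in _ `<=` X](closure_id _).1 //;
    exact: closure_subset.
by move=> clv; split; apply: sub clv => w [Xw Yw]; exact: ltW.
Qed.

Let points := nonzero_integer_points (closure cone).

Lemma points_polygon : points `<=` polygon.
Proof.
by move=> _ [[P /= P0 <-]] /closure_cone [XP YP]; exact: polygon_integer.
Qed.

Lemma points_V k (n : nat) : points (n.+1%:R *: rmx (V k)).
Proof.
split; last first.
  by apply: subset_closure; split; rewrite det2Zr mulr_gt0.
exists (n.+1%:Z *: V k); last by rewrite realmxZ.
apply/eqP => /(congr1 (fun w => det2 w (U k))) /eqP.
rewrite det2Zl detVU /det2 !mxE !mul0r subr0 mulf_eq0.
by rewrite (negPf (sqr_eq1_neq0 VU0)).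
Qed.

(** Every [v] in the polygon is [h] times a point of some edge, with [h >= 1] its height there, so
    it lies between [h V k] and [h V (k + 1)]. *)
Lemma polygon_hull : convex_hull points = polygon.
Proof.
apply/seteqP; split=> [|v Gv].
  apply: smallest_sub; last exact: points_polygon.
  by apply/convex_setP => v w t Gv Gw; exact: polygon_conv.
move=> B [/convex_setP convB ptB].
(* The point [h V k] lies between the integer points [n V k] and [(n + 1) V k], where [n >= 1] is
   the integer part of [h]. *)
have rayB k (h : R) : 1 <= h -> B (h *: rmx (V k)).
  move=> h1; have h0 : 0 <= h by exact: le_trans h1.
  have /andP[] := truncn_itv h0; set n := Num.truncn h => nh hn.
  have : (0 < n)%N by rewrite /n truncn_gt0.
  case: (n) nh hn => // m mh hm _.
  have := convB (m.+1%:R *: rmx (V k)) (m.+2%:R *: rmx (V k)) (h - m.+1%:R).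
  have -> : (1 - (h - m.+1%:R)) *: (m.+1%:R *: rmx (V k)) +
      (h - m.+1%:R) *: (m.+2%:R *: rmx (V k)) = h *: rmx (V k).
    by rewrite -[m.+2%:R]natr1; apply: cV2P; rewrite !mxE; ring.
  apply; [exact/ptB/points_V|exact/ptB/points_V|].
  by rewrite subr_ge0 mh /= lerBlDl natr1 ltW.
have [Xv Yv] := polygon_pos Gv.
have [k [h0 [t /= tI tE]]] := cone_cover Xv Yv.
have -> : v = (1 - t) *: (height k v *: rmx (V k)) +
    t *: (height k v *: rmx (V (k + 1))).
  transitivity (height k v *: ((height k v)^-1 *: v)).
    by rewrite scalerA mulfV ?scale1r // gt_eqF.
  by rewrite -tE scalerDr !scalerA !(mulrC (height k v)).
move: tI; rewrite in_itv /= => tI.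
by apply: convB => //; apply: rayB; exact: Gv.
Qed.

Definition sail_line : set 'cV[R]_2 := \bigcup_(k in [set: int]) edge k.

Lemma sail_line_polygon : sail_line `<=` polygon.
Proof. by move=> v [k _]; exact: edge_polygon. Qed.

Lemma boundary_polygon : boundary polygon = sail_line.
Proof.
rewrite /boundary -(closure_id _).1; last exact: closed_polygon.
apply/seteqP; split=> [v [Gv nGv]|v [k _ kv]].
  have [Xv Yv] := polygon_pos Gv.
  have [k [h0 kp]] := cone_cover Xv Yv; set p := _ *: v in kp.
  have := Gv k; rewrite le_eqVlt => /orP[/eqP h1|h1].
    by exists k => //; move: kp; rewrite /p -h1 invr1 scale1r.
  (* The point [p] of the sail is strictly below [v] in both [X] and [Y], and the polygon contains
     [p] plus the closed cone, so it is a neighbourhood of [v]. *)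
  case: nGv; have Xp : X p < X v.
    by rewrite /p det2Zr gtr_pMl // invf_lt1.
  have Yp : Y p < Y v by rewrite /p det2Zr gtr_pMl // invf_lt1.
  have op u : open (det2 u @^-1` [set t : R | det2 u p < t]).
    exact: (continuousP _).1 (@det2_continuous R _) _ (@open_gt _ _).
  rewrite /interior; apply: (@filterS _ _ _
      (det2 al @^-1` [set t | X p < t] `&` det2 be @^-1` [set t | Y p < t])).
    move=> w [/= Xw Yw]; rewrite -(subrK p w) addrC.
    apply: polygonD; first exact: edge_polygon kp.
      by rewrite det2Dr det2Nr subr_ge0 ltW.
    by rewrite det2Dr det2Nr subr_ge0 ltW.
  by apply: open_nbhs_nbhs; split=> //; apply: openI; exact: op.
split; first exact: edge_polygon kv.
(* Shrinking [v] slightly towards the origin makes its height less than 1, so [v] is not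
   interior. *)
move=> nv; have : nbhs (1 : R) [set t : R | polygon (t *: v)].
  have cv : {for (1 : R), continuous (fun t : R => t *: v)}.
    exact: scalel_continuous.
  by apply: cv; rewrite scale1r.
move=> /nbhs_ballP [e /= e0 /(_ (1 - e / 2))].
have ball_e : ball (1 : R) e (1 - e / 2).
  rewrite -ball_normE /= opprB addrC subrK ger0_norm ?divr_ge0 ?(ltW e0) //.
  by rewrite ltr_pdivrMr // ltr_pMr // ltr1n.
move=> /(_ ball_e) /(_ k); rewrite heightZ (edge_height kv) mulr1.
by rewrite lerBrDl gerDr leNgt divr_gt0.
Qed.

Lemma sailE : boundary (convex_hull (nonzero_integer_points (closure cone))) =
  sail_line.
Proof. by rewrite -/points polygon_hull boundary_polygon. Qed.

(** Ensures a genuine angle at [V k], whose edges are directed by [U (k - 1)] and [U k]. *)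
Lemma det2_UUS k : det2 (rmx (U (k - 1))) (rmx (U k)) != 0.
Proof.
have := rUS (k - 1); rewrite subrK => ->.
rewrite det2Dr det2xx add0r det2Zr mulf_neq0 //.
  by rewrite intr_eq0 gt_eqF.
have := rdetVSU (k - 1); rewrite subrK => h.
by rewrite det2C h oppr_eq0; exact: sqr_eq1_neq0 epsR2.
Qed.


Lemma rVB k : rmx (V (k + 1)) - rmx (V k) = (q (2 * k))%:~R *: rmx (U k).
Proof. by rewrite rVS addrAC subrr add0r. Qed.

Lemma V_inj : injective V.
Proof.
move=> k l kl; have [//|] := eqVneq k l; rewrite neq_lt.
by case/orP => /XV_lt; rewrite kl ltxx.
Qed.

Lemma broken_lineV : broken_line sail_line V.
Proof.
split=> [//||i /collinear_det2]; first exact: V_inj.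
have := rVB (i - 1); rewrite subrK => ->; rewrite rVB det2Zl det2Zr.
by move/eqP; rewrite !mulf_eq0 !intr_eq0 (negPf (det2_UUS i)) !gt_eqF.
Qed.

(** * Uniqueness of the vertices up to shift and reversal *)

Section BrokenLine.
Variable V' : int -> 'cV[int]_2.
Hypothesis V'P : broken_line sail_line V'.

(* The height is at least 1 at both ends of a piece and equals 1 at its
   midpoint, for the edge through the midpoint. *)
Lemma piece_in_edge i : exists k, edge k (rmx (V' i)) /\
  edge k (rmx (V' (i + 1))).
Proof.
case: V'P => XE _ _.
have sub t : 0 <= t <= 1 ->
    sail_line ((1 - t) *: rmx (V' i) + t *: rmx (V' (i + 1))).
  by move=> tI; rewrite XE; exists i => //; exists t.
have G0 : polygon (rmx (V' i)).
  apply: sail_line_polygon; have := sub 0.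
  by rewrite subr0 scale1r scale0r addr0; apply; rewrite lexx ler01.
have G1 : polygon (rmx (V' (i + 1))).
  apply: sail_line_polygon; have := sub 1.
  by rewrite subrr scale1r scale0r add0r; apply; rewrite lexx ler01.
have [|k _ /edge_height] := sub (2^-1); first by lra.
rewrite heightD !heightZ => hm; have := G0 k; have := G1 k => h1 h0.
by exists k; split; apply: polygon_edge => //; lra.
Qed.

(** The two pieces at [V' i] cannot lie on the same edge, since they form an angle, and two
    different edges only meet in a vertex. *)
Lemma vertex_of_sail i : exists j, V' i = V j.
Proof.
case: V'P => _ _ ncol.
have [k [k0 k1]] := piece_in_edge (i - 1); rewrite subrK in k1.
have [l [l1 l2]] := piece_in_edge i.
have [kl|kl|kl] := ltgtP k l.
- by exists (k + 1); apply: (@realmx_inj R); have [] := edge_meet kl k1 l1.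
- by exists (l + 1); apply: (@realmx_inj R); have [] := edge_meet kl l1 k1.
case: (ncol i); exists (rmx (V k)), (rmx (U k)) => x; move: l1 l2; rewrite -kl.
move=> /edgeP [b1 _ e1] /edgeP [b2 _ e2]; move/edgeP: k0 => [b0 _ e0].
by rewrite !inE => /or3P[] /eqP ->; [exists b0|exists b1|exists b2].
Qed.

(** The index map is injective, and consecutive values are the two ends of one edge, so it is a walk
    with unit steps that never turns back. *)
Lemma vertices_shift_or_reversal : exists s,
  (forall i : int, V' i = V (s + i)) \/ (forall i : int, V' i = V (s - i)).
Proof.
have [s sE] := choice vertex_of_sail; exists (s 0).
case: V'P => _ V'inj _.
have sinj i j : s i = s j -> i = j by move=> sij; apply: V'inj; rewrite !sE sij.
have [|i|up|down] := @int_walk s.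
- move=> i; have [k []] := piece_in_edge i; rewrite !sE.
  move=> /edge_vertex e0 /edge_vertex e1.
  have : s (i + 1) <> s i by move/sinj; lia.
  by case: e0 e1 => -> [] -> //; lia.
- by move/sinj; lia.
- by left=> i; rewrite sE up.
by right=> i; rewrite sE down.
Qed.

End BrokenLine.

(** * The LLS-sequence of the sail *)

Lemma detUV2 k : det2 (U k) (V k) ^+ 2 = 1.
Proof. by rewrite det2C sqrrN detVU. Qed.

Lemma detUVS2 k : det2 (U k) (V (k + 1)) ^+ 2 = 1.
Proof. by rewrite det2C sqrrN detVSU detVU. Qed.

Lemma il_edge k : (il R (V k) (V (k + 1)))%:Z = q (2 * k).
Proof. by rewrite VS (il_primitive R (detUV2 k)) // gtz0_abs. Qed.

(** Seen from [V (k + 1)], the edges are directed by [- U k] and by [U (k + 1) = U k + q (2 * k + 1)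
    V (k + 1)], where [U k] and [V (k + 1)] form a basis. *)
Lemma isin_vertex k :
  (isin R (V k) (V (k + 1)) (V (k + 2)))%:Z = q (2 * k + 1).
Proof.
have -> : V (k + 2) = V (k + 1) + q (2 * (k + 1)) *: (U k + q (2 * k +
  1) *: V (k + 1)).
  by rewrite -US -VS -addrA.
have {1}-> : V k = V (k + 1) + (- q (2 * k)) *: U k by rewrite VS scaleNr addrK.
by rewrite (isin_basis R _ (detUVS2 k)) ?oppr_eq0 ?gt_eqF // gtz0_abs.
Qed.

Lemma LLS_shift (V' : int -> 'cV[int]_2) (s : int) : (forall i :
  int, V' i = V (s + i)) ->
  forall i : int, LLS R V' i = q (i + 2 * s).
Proof.
move=> V'E i; rewrite /LLS /= !V'E !(addrA s).
have := divz_eq i 2; set k := (i %/ 2)%Z.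
case: ifPn => [/dvdz_mod0P i0|/dvdz_mod0P i0] kE.
  by rewrite il_edge; congr q; lia.
rewrite isin_vertex; congr q.
by lia.
Qed.

(** Read backwards, the edge leaving [V (s - k)] is the one with number [s - k - 1]; hence the
    offset [- 2]. *)
Lemma LLS_reversal (V' : int -> 'cV[int]_2) (s : int) : (forall i :
  int, V' i = V (s - i)) ->
  forall i : int, LLS R V' (- i) = q (i + (2 * s - 2)).
Proof.
move=> V'E i; rewrite /LLS /= !V'E.
have := divz_eq (- i) 2; set k := (- i %/ 2)%Z.
case: ifPn => [/dvdz_mod0P i0|/dvdz_mod0P i0] kE.
  have -> : s - k = s - (k + 1) + 1 by lia.
  by rewrite ilC il_edge; congr q; lia.
have -> : s - k = s - (k + 2) + 2 by lia.
have -> : s - (k + 1) = s - (k + 2) + 1 by lia.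
rewrite isinC isin_vertex; congr q.
by lia.
Qed.

Lemma LLS_sail (V' : int -> 'cV[int]_2) : broken_line sail_line V' -> exists s,
  (forall i : int, LLS R V' i = q (i + s)) \/
    (forall i : int, LLS R V' (- i) = q (i + s)).
Proof.
move=> /vertices_shift_or_reversal [s [/LLS_shift h|/LLS_reversal h]].
  by exists (2 * s); left.
by exists (2 * s - 2); right.
Qed.

Definition sails_LLS (O : set 'cV[R]_2) : Prop :=
  let S := boundary (convex_hull (nonzero_integer_points (closure O))) in
  (exists W, broken_line S W) /\
  forall V', broken_line S V' -> exists s : int,
    (forall i : int, LLS R V' i = q (i + s)) \/
    (forall i : int, LLS R V' (- i) = q (i + s)).

Lemma sails_LLS_cone : sails_LLS cone.
Proof.
rewrite /sails_LLS sailE; split; last exact: LLS_sail.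
by exists V; exact: broken_lineV.
Qed.

End Sail.

(** * Opposite and adjacent octants *)

Record sail_data (R : realType) (al be : 'cV[R]_2) (q : int -> int)
    (V U : int -> 'cV[int]_2) : Prop := SailData {
  quotients_gt0 : forall i, 0 < q i;
  VS_eq : forall i : int, V (i + 1) = V i + q (2 * i) *: U i;
  US_eq : forall i : int, U (i + 1) = U i + q (2 * i + 1) *: V (i + 1);
  VU_basis : det2 (V 0) (U 0) ^+ 2 = 1;
  XV_gt0 : forall i, 0 < det2 al (realmx R (V i));
  XU_gt0 : forall i, 0 < det2 al (realmx R (U i));
  YV_gt0 : forall i, 0 < det2 be (realmx R (V i));
  YU_lt0 : forall i, det2 be (realmx R (U i)) < 0 }.

Section SailData.
Variables (R : realType) (al be : 'cV[R]_2) (q : int -> int).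
Variables V U : int -> 'cV[int]_2.
Hypothesis sd : sail_data al be q V U.

Lemma sail_data_LLS : sails_LLS q (cone al be).
Proof. by case: sd => *; apply: (@sails_LLS_cone _ _ _ _ V U). Qed.

Lemma sail_data_opp :
  sail_data (- al) (- be) q (fun i => - V i) (fun i => - U i).
Proof.
case: sd => q0 VS US VU XV XU YV YU; split=> // [i|i||i|i|i|i].
- by rewrite VS scalerN opprD.
- by rewrite US scalerN opprD.
- by rewrite det2Nl det2Nr opprK.
all: by rewrite realmxN det2Nl det2Nr opprK.
Qed.

(** The sail with vertices [U k] has its edges along the [V (k + 1)], so lengths and sines exchange
    their roles and [q] is shifted by one. *)
Lemma sail_data_dual :
  sail_data al (- be) (fun i => q (i + 1)) U (fun i => V (i + 1)).
Proof.
case: sd => q0 VS US VU XV XU YV YU; split=> // [i||i|i].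
- by rewrite VS; congr (_ + q _ *: _); lia.
- by rewrite VS det2Dr det2Zr det2xx mulr0 addr0 det2C sqrrN.
- by rewrite det2Nl oppr_gt0.
- by rewrite det2Nl oppr_lt0.
Qed.

End SailData.

(** * Hyperbolic operators *)

Lemma mulmx2E (T : pzSemiRingType) (M : 'M[T]_2) (v : 'cV[T]_2) i :
  (M *m v) i 0 = M i 0 * v 0 0 + M i 1 * v 1 0.
Proof.
rewrite mxE !big_ord_recl big_ord0 addr0.
by congr (M i _ * v _ _ + M i _ * v _ _); apply: val_inj.
Qed.

Lemma det_mx22 (T : comNzRingType) (M : 'M[T]_2) :
  \det M = M 0 0 * M 1 1 - M 0 1 * M 1 0.
Proof.
rewrite (expand_det_row _ 0) !big_ord_recl big_ord0 /cofactor !det_mx11 !mxE /=.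
rewrite addr0 expr0 mul1r (_ : (0 + _)%N = 1%N) // expr1 mulN1r mulrN.
by congr (M _ _ * M _ _ - M _ _ * M _ _); apply: val_inj.
Qed.

Lemma horner_char_poly2 (T : comNzRingType) (M : 'M[T]_2) x :
  (char_poly M).[x] = x ^+ 2 - (M 0 0 + M 1 1) * x + \det M.
Proof.
rewrite /char_poly (det_mx22 (char_poly_mx M)) !mxE /= !mulr1n !mulr0n !sub0r
  det_mx22.
by rewrite !hornerE /=; ring.
Qed.

(** A rational root would be an integer dividing 1, but at [1] and [- 1] the values are [2 - t] and
    [2 + t], which do not vanish. *)
Lemma rat_quadratic_no_root (t : int) (x : rat) :
  3 <= t -> x ^+ 2 - t%:~R * x + 1 != 0.
Proof.
move=> t3; apply/eqP => x0.
have d0 : (denq x)%:~R != 0 :> rat by rewrite intr_eq0 denq_neq0.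
have nd : numq x ^+ 2 - t * numq x * denq x + denq x ^+ 2 = 0.
  apply: (@intr_inj rat); rewrite !rmorphD rmorphN !rmorphXn /= !rmorphM /=.
  have xE : x * (denq x)%:~R = (numq x)%:~R by rewrite -{1}(divq_num_den x)
    divfK.
  rewrite -xE; transitivity ((x ^+ 2 - t%:~R * x + 1) * (denq x)%:~R ^+ 2).
    by ring.
  by rewrite x0 mul0r.
have dn : (denq x %| numq x ^+ 2)%Z.
  apply/dvdzP; exists (t * numq x - denq x).
  by apply/eqP; rewrite -subr_eq0 -nd; apply/eqP; ring.
have cop : coprimez (denq x) (numq x) by rewrite coprimez_sym;
  exact: coprime_num_den.
have d1 : denq x = 1.
  have : (denq x %| 1)%Z.
    have := dn; rewrite expr2 Gauss_dvdzr // => dn1.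
    by rewrite -(Gauss_dvdzr _ cop) mulr1.
  by rewrite dvdz1 => /eqP; have := denq_gt0 x; lia.
move: nd; rewrite d1 mulr1 expr1n => nd.
have n1 : (numq x %| 1)%Z.
  by apply/dvdzP; exists (t - numq x); apply/eqP; rewrite -subr_eq0 -nd;
    apply/eqP; ring.
have : numq x = 1 \/ numq x = - 1 by move: n1; rewrite dvdz1 => /eqP; lia.
by case=> nE; move: nd; rewrite nE; lia.
Qed.

(** These are the roots of [x^2 - t x + 1], the characteristic polynomial for trace [t] and
    determinant 1. *)
Lemma quadratic_roots (R : realType) (t : int) : 3 <= t -> exists k l : R,
  [/\ k + l = t%:~R, k * l = 1, 1 < k & 0 < l < 1].
Proof.
move=> t3; have t3R : 3 <= t%:~R :> R by rewrite (ler_int _ 3).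
pose s : R := Num.sqrt (t%:~R ^+ 2 - 4).
have s2 : s ^+ 2 = t%:~R ^+ 2 - 4 by rewrite sqr_sqrtr //; nra.
have s0 : 0 <= s by exact: sqrtr_ge0.
by exists ((t%:~R + s) / 2), ((t%:~R - s) / 2); split; nra.
Qed.

Section Operator.
Variables (R : realType) (A : 'M[int]_2).
Notation rmx := (@realmx R _ _).
Hypothesis detA : \det A = 1.
Hypothesis A10_gt0 : 0 < A 1 0.
Hypothesis trA : 3 <= A 0 0 + A 1 1.

Lemma det_realmx : \det (rmx A) = 1.
Proof. by rewrite det_map_mx detA rmorph1. Qed.

Lemma realmxM (v : 'cV[int]_2) : rmx (A *m v) = rmx A *m rmx v.
Proof. exact: map_mxM. Qed.

Definition is_root (k : R) := k ^+ 2 - (A 0 0 + A 1 1)%:~R * k + 1 = 0.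

Lemma eigenvalueE k : eigenvalue (rmx A) k <-> is_root k.
Proof.
rewrite eigenvalue_root_char rootE horner_char_poly2 det_realmx !mxE -intrD.
by split=> /eqP.
Qed.

Lemma hyperbolicA : hyperbolic R A.
Proof.
have [k [l [kl1 kl2 k1 /andP[l0 l1]]]] := quadratic_roots R trA.
exists k, l; split; first by rewrite gt_eqF // (lt_trans l1).
  by apply/eigenvalueE; rewrite /is_root -kl1 -kl2; ring.
by apply/eigenvalueE; rewrite /is_root -kl1 -kl2; ring.
Qed.

Lemma sails_algebraicA : sails_algebraic R A.
Proof.
split=> //; first exact: hyperbolicA.
rewrite map_char_poly; apply: cubic_irreducible => [|x].
  by rewrite size_char_poly.
rewrite rootE horner_char_poly2 det_map_mx detA rmorph1 !mxE -intrD.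
exact: rat_quadratic_no_root.
Qed.

(* The linear form [det2 (eigenform k)] is a left eigenvector of A for k. *)
Definition eigenform (k : R) : 'cV[R]_2 :=
  \col_i (if i == 0 then k - (A 0 0)%:~R else - (A 1 0)%:~R).

Lemma eigenformE k v :
  det2 (eigenform k) v = (A 1 0)%:~R * v 0 0 + (k - (A 0 0)%:~R) * v 1 0.
Proof. by rewrite /det2 !mxE /=; ring. Qed.

Lemma eigenform_mulmx k v : is_root k ->
  det2 (eigenform k) (rmx A *m v) = k * det2 (eigenform k) v.
Proof.
move=> kr; rewrite !eigenformE !mulmx2E !mxE.
have dA : (A 0 0)%:~R * (A 1 1)%:~R - (A 0 1)%:~R * (A 1 0)%:~R = 1 :> R.
  by rewrite -!intrM -rmorphB /= -det_mx22 detA.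
apply/eqP; rewrite -subr_eq0; apply/eqP.
(* The difference of the two sides is a combination of [\det A = 1] and of the quadratic equation of
   [k]. *)
transitivity (v 1 0 * ((A 0 0)%:~R * (A 1 1)%:~R - (A 0 1)%:~R * (A 1 0)%:~R -
  1) * -1
  - v 1 0 * (k ^+ 2 - (A 0 0 + A 1 1)%:~R * k + 1)); last first.
  by rewrite dA (kr : _ = 0); ring.
by rewrite intrD; ring.
Qed.

(** * Octants of the operator *)

Variables k l : R.
Hypothesis kl_sum : k + l = (A 0 0 + A 1 1)%:~R.
Hypothesis kl_prod : k * l = 1.
Hypothesis k_gt1 : 1 < k.
Hypothesis l_gt0 : 0 < l.
Hypothesis l_lt1 : l < 1.

Notation X := (det2 (eigenform k)).
Notation Y := (det2 (eigenform l)).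

Lemma root_k : is_root k.
Proof. by rewrite /is_root -kl_sum -kl_prod; ring. Qed.

Lemma root_l : is_root l.
Proof. by rewrite /is_root -kl_sum -kl_prod; ring. Qed.

Lemma eigenvalue_kl r : eigenvalue (rmx A) r -> r = k \/ r = l.
Proof.
move=> /eigenvalueE; rewrite /is_root -kl_sum -kl_prod => r0.
have : (r - k) * (r - l) = 0 by rewrite -r0; ring.
by move/eqP; rewrite mulf_eq0 !subr_eq0 => /orP[] /eqP; [left|right].
Qed.

Lemma eigenform_indep : det2 (eigenform k) (eigenform l) != 0.
Proof.
rewrite eigenformE !mxE /= (_ : _ + _ = (A 1 0)%:~R * (l - k)); last by ring.
rewrite mulf_neq0 //; first by rewrite intr_eq0 gt_eqF.
by rewrite subr_eq0 lt_eqF // (lt_trans l_lt1).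
Qed.

(** A left eigenvector kills the right eigenvectors of the other eigenvalue, so [X] vanishes on the
    eigenline of [l] and [Y] on that of [k]. *)
Lemma eigenlinesE v : eigenlines A v <-> X v = 0 \/ Y v = 0.
Proof.
have kl : k - l != 0 by rewrite subr_eq0 gt_eqF // (lt_trans l_lt1).
split=> [[r /= /eigenvalue_kl rE Av]|].
  have XE := eigenform_mulmx v root_k; have YE := eigenform_mulmx v root_l.
  case: rE Av => -> Av; [right|left].
    move/eqP: YE; rewrite Av det2Zr -subr_eq0 -mulrBl mulf_eq0.
    by rewrite (negPf kl) => /eqP.
  move/eqP: XE; rewrite Av det2Zr eq_sym -subr_eq0 -mulrBl mulf_eq0.
  by rewrite (negPf kl) => /eqP.
have ev r : is_root r -> X (rmx A *m v - r *: v) = 0 ->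
    Y (rmx A *m v - r *: v) = 0 -> eigenlines A v.
  move=> rr X0 Y0; exists r; first exact/eigenvalueE.
  by apply/eqP; rewrite -subr_eq0; apply/eqP/(det2_separates eigenform_indep).
case=> v0; [apply: (ev _ root_l)|apply: (ev _ root_k)];
  rewrite det2Dr det2Nr det2Zr eigenform_mulmx ?v0 ?mulr0 ?subrr //;
  by [exact: root_k|exact: root_l].
Qed.

Lemma octant_cone O : octant A O -> exists s t : bool,
  O = cone ((-1) ^+ s *: eigenform k) ((-1) ^+ t *: eigenform l).
Proof.
case=> v /= nv ->.
have X0 : X v != 0 by apply: contra_not_neq nv => h; apply/eigenlinesE; left.
have Y0 : Y v != 0 by apply: contra_not_neq nv => h; apply/eigenlinesE; right.
exists (X v < 0), (Y v < 0).
set a := _ *: eigenform k; set b := _ *: eigenform l.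
have av : 0 < det2 a v.
  rewrite /a det2Zl; case: (ltrgt0P (X v)) X0 => // h _;
    rewrite ?expr0 ?mul1r //.
  by rewrite expr1 mulN1r oppr_gt0.
have bv : 0 < det2 b v.
  rewrite /b det2Zl; case: (ltrgt0P (Y v)) Y0 => // h _;
    rewrite ?expr0 ?mul1r //.
  by rewrite expr1 mulN1r oppr_gt0.
have ncone w : cone a b w -> (~` eigenlines A) w.
  move=> [aw bw] /eigenlinesE [] w0; [move: aw|move: bw].
    by rewrite det2Zl w0 mulr0 ltxx.
  by rewrite det2Zl w0 mulr0 ltxx.
apply/seteqP; split=> [w [C [Cv Csub Cc] Cw]|w [aw bw]].
  (* On a connected set off the eigenlines the two forms do not vanish, so by the intermediate value
     property they keep their signs. *)
  have pos c : (forall u, C u -> det2 c u != 0) -> 0 < det2 c v -> 0 < det2 c w.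
    move=> cn cv; rewrite ltNge; apply/negP => cw.
    have /connected_intervalP ci : connected (det2 c @` C).
      apply: connected_continuous_connected => //.
      by apply: continuous_subspaceT; exact: det2_continuous.
    have [u Cu u0] : (det2 c @` C) 0.
      apply: (ci (det2 c w) (det2 c v)); [by exists w|by exists v|].
      by rewrite cw ltW.
    by have := cn u Cu; rewrite u0 eqxx.
  split; apply: pos => // u Cu; rewrite det2Zl mulf_neq0 ?signr_eq0 //;
    by apply/eqP => u0; case: (Csub u Cu); apply/eigenlinesE; auto.
(* Conversely, the cone is convex and avoids the eigenlines, so the segment from [v] to [w] connects
   them. *)
pose f (t : R) := v + t *: (w - v).
have fE t : f t = (1 - t) *: v + t *: w.
  by apply: cV2P; rewrite !mxE; ring.
apply: (@connected_component_max _ _ (f @` `[0, 1])).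
- by exists 0; rewrite /= ?in_itv /= ?lexx ?ler01 // /f scale0r addr0.
- move=> _ [t /= tI <-]; apply: ncone; rewrite fE; move: tI; rewrite in_itv /=.
  move=> /andP[t0 t1]; have t1' : 0 <= 1 - t by rewrite subr_ge0.
  have [->|tn0] := eqVneq t 0; first by rewrite subr0 scale1r scale0r addr0.
  have tp : 0 < t by rewrite lt_neqAle eq_sym tn0.
  by split; rewrite det2Dr !det2Zr ltr_wpDl ?mulr_gt0 // mulr_ge0 // ltW.
- apply: connected_continuous_connected; first exact: segment_connected.
  apply: continuous_subspaceT => t; apply: cvgD; first exact: cvg_cst.
  exact: scalel_continuous.
- by exists 1; rewrite /= ?in_itv /= ?lexx ?ler01 // /f scale1r addrC subrK.
Qed.


(** * Convergents on which the operator acts as a shift *)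

Section Shift.
Variables (q : int -> int) (V U : int -> 'cV[int]_2) (m : int).
Hypothesis q_gt0 : forall i, 0 < q i.
Hypothesis VS : forall i : int, V (i + 1) = V i + q (2 * i) *: U i.
Hypothesis US : forall i : int, U (i + 1) = U i + q (2 * i + 1) *: V (i + 1).
Hypothesis m_gt0 : 0 < m.
Hypothesis q_per : forall i : int, q (i + 2 * m) = q i.
Hypothesis AV0 : A *m V 0 = V m.
Hypothesis AU0 : A *m U 0 = U m.

(** Both sides obey the same invertible recurrence, as [q] repeats after [2 * m], and they agree at
    0. *)
Lemma mulmx_shift (i : int) : A *m V i = V (i + m) /\ A *m U i = U (i + m).
Proof.
move: i; apply: int_shift_ind => [|i]; first by rewrite add0r.
have q0 : q (2 * (i + m)) = q (2 * i) by rewrite -[RHS]q_per; congr q; lia.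
have q1 : q (2 * (i + m) + 1) = q (2 * i + 1) by rewrite -[RHS]q_per; congr q;
  lia.
have im : i + 1 + m = i + m + 1 by lia.
rewrite im US VS [U (i + m + 1)]US VS q0 q1.
rewrite !mulmxDr -!scalemxAr mulmxDr -!scalemxAr.
split=> [[-> ->]//|[EV EU]].
have EU' : A *m U i = U (i + m).
  by move: EU; rewrite EV => /addIr.
by move: EV; rewrite EU' => /addIr.
Qed.

Lemma eigenform_shift r (w : int -> 'cV[int]_2) : is_root r ->
  (forall i : int, A *m w i = w (i + m)) -> forall (i : int) (j : nat),
  det2 (eigenform r) (rmx (w (i + m * j%:Z))) =
  r ^+ j * det2 (eigenform r) (rmx (w i)).
Proof.
move=> rr Aw i; elim=> [|j IH]; first by rewrite mulr0 addr0 mul1r.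
rewrite PoszS mulrDr mulr1 addrA -Aw realmxM eigenform_mulmx // IH.
by rewrite exprS mulrA.
Qed.

Hypothesis XV0 : 0 < X (rmx (V 0)).
Hypothesis XU0 : 0 < X (rmx (U 0)).
Hypothesis YV0 : 0 < Y (rmx (V 0)).
Hypothesis YU0 : Y (rmx (U 0)) < 0.

(** The recurrences preserve positivity going forward. Any index becomes nonnegative after adding
    [m * |i|], and this power of [A] multiplies [X] by a power of [k > 0]. *)
Lemma X_gt0 (i : int) : 0 < X (rmx (V i)) /\ 0 < X (rmx (U i)).
Proof.
have qR j : 0 < (q j)%:~R :> R by rewrite ltr0z.
have pos (n : nat) : 0 < X (rmx (V n)) /\ 0 < X (rmx (U n)).
  elim: n => // n [XVn XUn]; rewrite PoszS US VS !(realmxD, realmxZ).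
  have XVn' : 0 < X (rmx (V n)) + (q (2 * n))%:~R * X (rmx (U n)).
    by rewrite addr_gt0 // mulr_gt0.
  by rewrite !det2Dr !det2Zr !det2Dr !det2Zr; split=> //;
    rewrite addr_gt0 // mulr_gt0.
have [n nE] : exists n : nat, n%:Z = i + m * `|i|%N%:Z by exists (absz (i +
  m * `|i|%N%:Z)); nia.
have k0 : 0 < k ^+ `|i| by rewrite exprn_gt0 // (lt_trans ltr01).
have [] := pos n; rewrite nE (eigenform_shift root_k (fun j =>
  (mulmx_shift j).1)).
rewrite (eigenform_shift root_k (fun j => (mulmx_shift j).2)).
by rewrite !pmulr_rgt0.
Qed.

(** Run backward, the recurrences preserve these signs. Powers of [A] lead from nonpositive indices
    to all others and multiply [Y] by powers of [l > 0]. *)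
Lemma Y_sign (i : int) : 0 < Y (rmx (V i)) /\ Y (rmx (U i)) < 0.
Proof.
have qR j : 0 < (q j)%:~R :> R by rewrite ltr0z.
have neg (n : nat) : 0 < Y (rmx (V (- n%:Z))) /\ 0 < - Y (rmx (U (- n%:Z))).
  elim: n => [|n]; first by rewrite oppr0 oppr_gt0.
  have -> : - n%:Z = - n.+1%:Z + 1 by lia.
  set j := - n.+1%:Z => -[YVj YUj].
  have : 0 < - Y (rmx (U j)).
    have -> : - Y (rmx (U j)) = - Y (rmx (U (j + 1))) + (q (2 * j +
      1))%:~R * Y (rmx (V (j + 1))).
      by rewrite US realmxD realmxZ det2Dr det2Zr; ring.
    by rewrite addr_gt0 // mulr_gt0.
  split=> //; have -> : Y (rmx (V j)) = Y (rmx (V (j + 1))) +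
    (q (2 * j))%:~R * - Y (rmx (U j)).
    by rewrite VS realmxD realmxZ det2Dr det2Zr; ring.
  by rewrite addr_gt0 // mulr_gt0.
have [n nE] : exists n : nat, - n%:Z = i - m * `|i|%N%:Z.
  by pose z := i - m * `|i|%N%:Z; exists (absz z); rewrite /z; nia.
have l0 : 0 < l ^+ `|i| by rewrite exprn_gt0.
have iE : i = - n%:Z + m * `|i|%N%:Z by rewrite nE subrK.
rewrite iE (eigenform_shift root_l (fun j => (mulmx_shift j).1)).
rewrite (eigenform_shift root_l (fun j => (mulmx_shift j).2)).
have [YVn] := neg n; rewrite oppr_gt0 => YUn.
by rewrite (pmulr_rgt0 _ l0) (pmulr_rlt0 _ l0).
Qed.

Hypothesis VU0 : det2 (V 0) (U 0) ^+ 2 = 1.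

Lemma eigen_sail_data : sail_data (eigenform k) (eigenform l) q V U.
Proof.
by split=> // i; [have [] := X_gt0 i|have [] := X_gt0 i|have [] := Y_sign i
  |have [] := Y_sign i].
Qed.

Lemma octant_LLS (O : set 'cV[R]_2) : octant A O ->
  sails_LLS q O \/ sails_LLS (fun i => q (i + 1)) O.
Proof.
have sd := eigen_sail_data.
(* The four sign patterns belong to the vertices [- V i], [- U i], [U i] and [V i], in this
   order. *)
move=> /octant_cone [[] [[] ->]]; rewrite ?expr0 ?expr1 ?scale1r ?scaleN1r.
- by left; exact: sail_data_LLS (sail_data_opp sd).
- right; rewrite -[eigenform l]opprK.
  exact: sail_data_LLS (sail_data_opp (sail_data_dual sd)).
- by right; exact: sail_data_LLS (sail_data_dual sd).
- by left; exact: sail_data_LLS sd.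
Qed.

Lemma LLS_period_of_shift (p : seq int) : p != [::] ->
  (forall i : int, q i = p`_(`|(i %% size p)%Z|%N)) -> LLS_period R A p.
Proof.
move=> pn0 qE S [oct /octant_LLS sO SE].
have per (s : int) (f : int -> int) : (forall i : int, f i = q (i +
  s)) -> is_period p f.
  by move=> fE; split=> //; exists (- s) => i; rewrite fE subrK qE.
case: sO; rewrite /sails_LLS -SE => -[WS LS]; split=> // V' /LS [s [h|h]].
- by left; exact: per h.
- by right; exact: per h.
- by left; apply: (per (s + 1)) => i; rewrite h addrA.
- by right; apply: (per (s + 1)) => i; rewrite h addrA.
Qed.

End Shift.

End Operator.

(** * Periodic continued fractions *)

(** The right inverses [G i] extend the orbit to negative indices. *)
Lemma int_orbit (T : Type) (F G : int -> T -> T) (x : T) :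
  (forall i y, F i (G i y) = y) ->
  exists f : int -> T, f 0 = x /\ forall i : int, f (i + 1) = F i (f i).
Proof.
move=> FG.
pose fwd := fix fwd (n : nat) := if n is n'.+1 then F n'%:Z (fwd n') else x.
pose bwd := fix bwd (n : nat) := G (Negz n) (if n is n'.+1 then bwd n' else x).
exists (fun i => match i with Posz n => fwd n | Negz n => bwd n end);
  split=> //.
case=> [n|[|n]]; first by rewrite -PoszS.
  by rewrite (_ : Negz 0 + 1 = 0) //= FG.
by rewrite (_ : Negz n.+1 + 1 = Negz n) ?FG //; lia.
Qed.

Lemma exists_convergents (q : int -> int) (v u : 'cV[int]_2) :
  exists V U : int -> 'cV[int]_2, [/\ V 0 = v, U 0 = u,
    forall i : int, V (i + 1) = V i + q (2 * i) *: U i &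
    forall i : int, U (i + 1) = U i + q (2 * i + 1) *: V (i + 1)].
Proof.
pose F i (w : 'cV[int]_2 * 'cV[int]_2) :=
  let v' := w.1 + q (2 * i) *: w.2 in (v', w.2 + q (2 * i + 1) *: v').
pose G i (w : 'cV[int]_2 * 'cV[int]_2) :=
  let u' := w.2 - q (2 * i + 1) *: w.1 in (w.1 - q (2 * i) *: u', u').
have FG i w : F i (G i w) = w by case: w => w1 w2; rewrite /F /G /= !subrK.
have [f [f0 fS]] := int_orbit (v, u) FG.
by exists (fun i => (f i).1), (fun i => (f i).2); split; rewrite ?f0 // => i;
  rewrite fS.
Qed.

(** One element acts on the last two convergents. Two steps lead from [(V j, U j)] to
    [(V (j + 1), U (j + 1))], the vectors exchanging places in between. *)
Definition cf_step (w : 'cV[int]_2 * 'cV[int]_2) (x : int) :=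
  (w.2, w.1 + x *: w.2).

Lemma foldl_convergents (p : seq int) (q : int -> int) (V U :
  int -> 'cV[int]_2) :
  (forall i : int, V (i + 1) = V i + q (2 * i) *: U i) ->
  (forall i : int, U (i + 1) = U i + q (2 * i + 1) *: V (i + 1)) ->
  (forall i : nat, (i < size p)%N -> p`_i = q i) ->
  forall j : nat, (j.*2 <= size p)%N ->
  foldl cf_step (V 0, U 0) (take j.*2 p) = (V j, U j).
Proof.
move=> VS US pq; elim=> [|j IH] jp; first by rewrite take0.
rewrite doubleS in jp; rewrite doubleS (take_nth 0) // (take_nth 0);
  last exact: ltnW.
rewrite !foldl_rcons IH; last by lia.
rewrite !pq //; last exact: ltnW.
rewrite [j.+1%:Z]PoszS US VS /cf_step /=;
  congr (_ + q _ *: _, _ + q _ *: (_ + q _ *: _)); lia.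
Qed.

(** Common core of both cases. The convergents are built from the periodic extension of [p]; since
    folding [p] over the starting basis yields its image, [A] shifts their index by half the length
    of [p]. *)
Lemma periodic_sails (R : realType) (A : 'M[int]_2) (p : seq int)
    (v u : 'cV[int]_2) :
  \det A = 1 -> 0 < A 1 0 -> 3 <= A 0 0 + A 1 1 ->
  p != [::] -> ~~ odd (size p) -> all (fun x => 0 < x) p ->
  det2 v u ^+ 2 = 1 -> foldl cf_step (v, u) p = (A *m v, A *m u) ->
  (forall k l : R, k + l = (A 0 0 + A 1 1)%:~R -> 1 < k -> 0 < l -> l < 1 ->
    [/\ 0 < det2 (eigenform A k) (realmx R v), 0 < det2 (eigenform A k) (realmx
      R u),
        0 < det2 (eigenform A l) (realmx R v) & det2 (eigenform A l) (realmx R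
          u) < 0]) ->
  LLS_period R A p.
Proof.
move=> detA A10 trA pn0 pe ppos vu foldA signs.
have [k [l [kl1 kl2 k1 /andP[l0 l1]]]] := quadratic_roots R trA.
have [Xv Xu Yv Yu] := signs k l kl1 k1 l0 l1.
pose q (i : int) : int := p`_(`|(i %% size p)%Z|%N).
have sp : (0 < size p)%N by case: (p) pn0.
have q_gt0 i : 0 < q i.
  apply: (allP ppos); apply: mem_nth;
    rewrite -ltz_nat gez0_abs ?modz_ge0 ?ltz_pmod //.
  by case: (p) pn0.
have [V [U [V0 U0 VS US]]] := exists_convergents q v u.
pose m := (size p)./2.
have m2 : m.*2 = size p by rewrite -[RHS]odd_double_half (negPf pe).
have [] : V m = A *m v /\ U m = A *m u.
  have := foldl_convergents (p := p) VS US _ (j := m).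
  rewrite m2 leqnn take_size V0 U0 foldA => h.
  have [] // : (A *m v, A *m u) = (V m, U m).
  apply: h => // i ip; rewrite /q modz_small // le0z_nat ltz_nat.
rewrite -V0 -U0 => AV AU.
apply: (@LLS_period_of_shift R A detA A10 trA k l kl1 kl2 k1 l0 l1 q V U m) =>
  //.
- by rewrite ltz_nat; move: sp; rewrite -m2 double_gt0.
- move=> i; rewrite /q (_ : 2 * m%:Z = size p) ?modzDr //.
  by rewrite -m2 -mul2n PoszM.
- by rewrite V0.
- by rewrite U0.
- by rewrite V0.
- by rewrite U0.
- by rewrite V0 U0.
Qed.

(** Numerator and denominator of [cfrac]. The empty sequence stands for 1/0, whose value 0 in [rat]
    agrees with [cfrac]. *)
Fixpoint cf_pair (s : seq int) : int * int :=
  if s is x :: s' then (x * (cf_pair s').1 + (cf_pair s').2, (cf_pair s').1)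
  else (1, 0).

Lemma foldl_cf_pair s v u :
  (foldl cf_step (v, u) s).2 = (cf_pair s).1 *: u + (cf_pair s).2 *: v.
Proof.
elim: s v u => [|x s IH] v u /=; first by rewrite scale1r scale0r addr0.
rewrite IH /=; apply: cV2P; rewrite !mxE; ring.
Qed.

(** A step exchanges the two vectors up to a shear, so it changes the sign of the determinant. *)
Lemma foldl_cf_det s v u : let w := foldl cf_step (v, u) s in
  det2 w.1 w.2 = (-1) ^+ size s * det2 v u.
Proof.
elim: s v u => [|x s IH] v u /=; first by rewrite mul1r.
by rewrite IH det2Dr det2Zr det2xx mulr0 addr0 exprS det2C; ring.
Qed.

(** Provides the bounds that identify the last but one convergent with [(c, d)]. *)
Lemma foldl_cf_mono s (v u : 'cV[int]_2) : s != [::] -> all (fun x : int =>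
  0 < x) s ->
  0 <= v 1 0 -> 0 < u 1 0 -> let w := foldl cf_step (v, u) s in
  0 < w.1 1 0 <= w.2 1 0.
Proof.
elim: s v u => // x s IH v u _ /= /andP[x0 s0] v0 u0.
case: (s) s0 IH => [|y s'] s0 IH; first by rewrite /= !mxE u0 /=; nia.
by apply: IH => //=; rewrite ?ltW // !mxE ltr_wpDl // mulr_gt0.
Qed.

Lemma cf_pair_pos s : all (fun x : int => 0 < x) s ->
  [/\ 0 < (cf_pair s).1, 0 <= (cf_pair s).2, (cf_pair s).2 <= (cf_pair s).1 &
      cfrac s = (cf_pair s).1%:~R / (cf_pair s).2%:~R].
Proof.
elim: s => [|x s IH] /=; first by split=> //; rewrite invr0 mulr0.
move=> /andP[x0 /IH [P0 Q0 QP ->]]; split; [nia|exact: ltW|nia|].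
have Pn : (cf_pair s).1%:~R != 0 :> rat by rewrite intr_eq0 gt_eqF.
by rewrite invf_div rmorphD rmorphM /= mulrDl mulfK.
Qed.

(** By definition only the elements after the first are positive. The first is positive as well,
    because the value exceeds 1 while the rest contributes at most 1. *)
Lemma odd_ocf_pair s (q : rat) : odd_ocf s q -> 1 < q ->
  [/\ all (fun x : int => 0 < x) s, 0 < (cf_pair s).2 &
      q = (cf_pair s).1%:~R / (cf_pair s).2%:~R].
Proof.
case: s => [|x s] [] //= _ spos <- gt1.
have [P0 Q0 QP cfE] := cf_pair_pos spos.
have Pn : (cf_pair s).1%:~R != 0 :> rat by rewrite intr_eq0 gt_eqF.
have qE : x%:~R + (cfrac s)^-1 =
    (x * (cf_pair s).1 + (cf_pair s).2)%:~R / (cf_pair s).1%:~R :> rat.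
  by rewrite cfE invf_div rmorphD rmorphM /= mulrDl mulfK.
split=> //; rewrite spos andbT; move: gt1; rewrite qE ltr_pdivlMr ?ltr0z //.
by rewrite mul1r ltr_int; nia.
Qed.

(** * Identification of the last two convergents *)

Definition vec2 (x y : int) : 'cV[int]_2 := \col_i (if i == 0 then x else y).

(** Both fractions are in lowest terms by the Bezout relations, so each denominator divides the
    other. *)
Lemma eq_denominators (a b c d P Q c' d' : int) : 0 < a -> 0 < Q ->
  b * Q = P * a -> a * d - b * c = 1 -> Q * d' - P * c' = 1 -> a = Q.
Proof.
move=> a0 Q0 bQ e e'.
have aE : a = Q * (a * d' - b * c').
  transitivity (a * (Q * d' - P * c')); first by rewrite e' mulr1.
  have -> : Q * (a * d' - b * c') = Q * a * d' - b * Q * c' by ring.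
  by rewrite bQ; ring.
have QE : Q = a * (Q * d - P * c).
  transitivity (Q * (a * d - b * c)); first by rewrite e mulr1.
  have -> : Q * (a * d - b * c) = Q * a * d - b * Q * c by ring.
  by rewrite bQ; ring.
move: aE QE; set x := _ - _; set y := _ - _; clearbody x y => aE QE.
have x0 : 0 < x by rewrite -(pmulr_rgt0 _ Q0) -aE.
have y0 : 0 < y by rewrite -(pmulr_rgt0 _ a0) -QE.
by nia.
Qed.

(** The solutions [(c, d)] of the Bezout equation differ by multiples of [(a, b)], and the bounds
    confine [d] to one residue system modulo [b]. *)
Lemma bezout_unique (a b c d c' d' : int) :
  a * d - b * c = 1 -> a * d' - b * c' = 1 -> 0 < d -> d <= b -> 0 < d' ->
  d' <= b -> c = c' /\ d = d'.
Proof.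
move=> e e' d0 db d'0 d'b.
have dE : d - d' = b * (d * (c - c') - c * (d - d')).
  transitivity ((d - d') * (a * d - b * c)); first by rewrite e mulr1.
  transitivity (d * (a * d - a * d') - b * c * (d - d')); first by ring.
  have -> : a * d - a * d' = b * (c - c') by lia.
  by ring.
have dd : d = d'.
  have b0 : 0 < b by exact: lt_le_trans db.
  move: dE; set z := _ - c * _; clearbody z => dE.
  have [zn|zp|z0] := ltgtP z 0; last by move: dE; rewrite z0; lia.
    have : b * z <= b * - 1 by rewrite ler_pM2l //; lia.
    by lia.
  have : b * 1 <= b * z by rewrite ler_pM2l //; lia.
  by lia.
split=> //; apply: (@mulfI _ b); first by rewrite gt_eqF // (lt_le_trans d0).
by move: e e'; rewrite -dd; lia.
Qed.

(** The last convergent is [b / a] in lowest terms. As the length is odd, the last two have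
    determinant -1, so the last but one solves the Bezout equation of [(c, d)] within the same
    bounds. *)
Lemma last_convergents (a b c d : int) (s : seq int) :
  a * d - b * c = 1 -> 1 <= a -> a < b -> 0 < d -> d <= b ->
  odd_ocf s (b%:~R / a%:~R) ->
  all (fun x : int => 0 < x) s /\
  foldl cf_step (vec2 1 0, vec2 0 1) s = (vec2 c d, vec2 a b).
Proof.
move=> det1 a1 ab d0 db sq; have a0 : 0 < a by lia.
have [|spos Q0 abE] := odd_ocf_pair sq.
  by rewrite ltr_pdivlMr ?ltr0z // mul1r ltr_int.
split=> //; case: sq => sodd _ _.
have /= := foldl_cf_det s (vec2 1 0) (vec2 0 1).
have /= := foldl_cf_pair s (vec2 1 0) (vec2 0 1).
have sn0 : s != [::] by case: (s) sodd.
have /= := foldl_cf_mono sn0 spos (_ : 0 <=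
  vec2 1 0 1 0) (_ : 0 < vec2 0 1 1 0).
rewrite !mxE => /(_ isT isT).
case: (foldl _ _ _) => w1 w2 /= mono w2E.
move: abE Q0 w2E; case: (cf_pair s) => P Q /= abE Q0 w2E det2w.
have {}abE : b * Q = P * a.
  apply: (@intr_inj rat); rewrite !rmorphM /=; move/eqP: abE.
  by rewrite eqr_div => [/eqP||] //; rewrite intr_eq0 gt_eqF.
have {}w2E : w2 = vec2 Q P by rewrite w2E; apply: cV2P; rewrite !mxE /=; ring.
move: mono det2w; rewrite {}w2E -signr_odd sodd expr1 /det2 !mxE /=.
set c' := w1 0 0; set d' := w1 1 0 => /andP[d'0 d'P] detw.
have {}detw : Q * d' - P * c' = 1 by lia.
have aQ : a = Q by exact: (eq_denominators a0 Q0 abE det1 detw).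
have bP : b = P by apply: (@mulIf _ Q); rewrite ?gt_eqF // abE aQ.
rewrite -aQ -bP in detw d'P *.
have [|cc dd] := bezout_unique det1 detw d0 db d'0; first by [].
by rewrite dd cc; congr pair; apply: cV2P; rewrite !mxE.
Qed.

(** * The two families of operators *)

Lemma mx2_vec2 (a c b d x y : int) :
  mx2 a c b d *m vec2 x y = vec2 (a * x + c * y) (b * x + d * y).
Proof. by apply: cV2P; rewrite mulmx2E !mxE. Qed.

Theorem theorem1 (R : realType) (a b c d lambda : int) :
  a * d - b * c = 1 ->
  let A : 'M[int]_2 := mx2 a (c + lambda * a)
                           b (d + lambda * b) in
  (a = 0 -> b = 1 -> d = 1 -> 2 < lambda ->
     [/\ hyperbolic R A, sails_algebraic R A &
         LLS_period R A [:: 1; lambda - 1]]) /\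
  (1 <= a -> a < b -> 0 < d -> d <= b -> 1 <= lambda ->
     forall s : seq int, odd_ocf s (b%:~R / a%:~R) ->
     [/\ hyperbolic R A, sails_algebraic R A &
         LLS_period R A (rcons s lambda)]).
Proof.
move=> det1 A.
have detA : \det A = 1 by rewrite det_mx22 !mxE /= -det1; ring.
have A00 : A 0 0 = a by rewrite mxE.
have A10 : A 1 0 = b by rewrite mxE.
have A11 : A 1 1 = d + lambda * b by rewrite mxE.
split=> [a0 b1 d1 lambda2|a1 ab d0 db lambda1 s sq].
  have trA : 3 <= A 0 0 + A 1 1 by rewrite A00 A11 a0 b1 d1; lia.
  have A10_gt0 : 0 < A 1 0 by rewrite A10 b1.
  split; [exact: hyperbolicA|exact: sails_algebraicA|].
  (* Here [e_2] cannot serve as [U 0]: since [a = 0], the form for [l] is [l > 0] there, but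
     [l - 1 < 0] at [e_2 - e_1]. *)
  apply: (@periodic_sails R A _ (vec2 1 0) (vec2 (- 1) 1)) => //=.
  - by rewrite andbT; lia.
  - by rewrite /det2 !mxE.
  - have cE : c = - 1 by move: det1; rewrite a0 b1; lia.
    rewrite /A !mx2_vec2 /cf_step /= cE a0 b1 d1.
    by congr pair; apply: cV2P; rewrite !mxE /=; ring.
  - move=> k l _ k1 l0 l1; rewrite !eigenformE A00 A10 a0 b1 !mxE /=.
    by split; lra.
have trA : 3 <= A 0 0 + A 1 1 by rewrite A00 A11; nia.
have A10_gt0 : 0 < A 1 0 by rewrite A10; lia.
have [spos foldE] := last_convergents det1 a1 ab d0 db sq.
split; [exact: hyperbolicA|exact: sails_algebraicA|].
apply: (@periodic_sails R A _ (vec2 1 0) (vec2 0 1)) => //=.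
- by case: (s).
- by rewrite size_rcons /= negbK; case: sq.
- by rewrite all_rcons spos andbT; lia.
- by rewrite /det2 !mxE.
(* The final element [lambda] turns [(c, d)], [(a, b)] into [(a, b)],
   [(c + lambda a, d + lambda b)], the columns of [A]. *)
- rewrite foldl_rcons foldE /cf_step /A !mx2_vec2 /=.
  by congr pair; apply: cV2P; rewrite !mxE /=; ring.
move=> k l klE k1 l0 l1.
(* Both forms equal [b] at [e_1]; at [e_2] they are [k - a = d + lambda b - l > 0] and
   [l - a < 0]. *)
have a1R : 1 <= a%:~R :> R by rewrite ler1z.
have b0R : 0 < b%:~R :> R by rewrite ltr0z; lia.
have dbR : 1 <= (d + lambda * b)%:~R :> R by rewrite ler1z; nia.
move: klE; rewrite intrD A00 A11 => klE.
by rewrite !eigenformE A00 A10 !mxE /=; split; nra.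
Qed.
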